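(* Let $\Sigma$ be a rational fan in $\mathbb{R}^n$ and let $Y$ be the real toric variety defined by $\Sigma$. Then $Y^\circ$ is orientable if and only if there exists a basis of $\{\pm1\}^n$ such that, for each primitive vector $b\in\mathbb{Z}^n$ lying on a ray of $\Sigma$, the element $(-1)^b$ is a product of an odd number of basis vectors.
   Context: A rational fan is a finite fan of strongly convex rational polyhedral cones with respect to the lattice $\mathbb{Z}^n\subset\mathbb{R}^n$. The real toric variety $Y$ is the canonical set of real points (with the usual topology) of the complex toric variety of $\Sigma$; it is the disjoint union of the real points $\mathcal{O}_\sigma(\mathbb{R})\simeq(\mathbb{R}^\times)^{n-\dim\sigma}$ of the torus orbits $\mathcal{O}_\sigma$, $\sigma\in\Sigma$. $Y^\circ$ denotes the union of the dense orbit $\mathcal{O}_0(\mathbb{R})\simeq(\mathbb{R}^\times)^n$ and the orbits $\mathcal{O}_\sigma(\mathbb{R})$ for the one-dimensional cones (rays) $\sigma$; it is an open subset of $Y$ consisting of smooth points. A (possibly disconnected) manifold is orientable if each of its components is. For $v=(v_1,\dots,v_n)\in\mathbb{Z}^n$, $(-1)^v:=((-1)^{v_1},\dots,(-1)^{v_n})\in\{\pm1\}^n$. The group $\{\pm1\}^n$ is regarded as an $n$-dimensional vector space over $\mathbb{Z}/2\mathbb{Z}$, written multiplicatively; ''basis'' means a basis of this vector space, and ''a product of an odd number of basis vectors'' means a product of an odd number of distinct elements of the basis. *)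

(* Defs.v *)
From HB Require Import structures.
From Stdlib Require Import Relations.Relation_Operators.
From mathcomp Require Import all_boot all_order all_algebra generic_quotient.
From mathcomp Require Import all_classical all_reals all_analysis.
Import Order.TTheory GRing.Theory Num.Theory.
Import numFieldNormedType.Exports.

Set Implicit Arguments.
Unset Strict Implicit.
Unset Printing Implicit Defensive.

Local Open Scope classical_set_scope.
Local Open Scope ring_scope.
Local Open Scope quotient_scope.

Section RationalFans.
Context {R : realType} {n : nat}.
Implicit Types (sigma tau : set 'rV[R]_n) (Sigma : set (set 'rV[R]_n)).

Definition lattice_point (v : 'rV[int]_n) : 'rV[R]_n := map_mx intr v.

Definition pairing (m u : 'rV[R]_n) : R := \sum_i m 0 i * u 0 i.

Definition rational_polyhedral sigma : Prop :=
  exists (k : nat) (v : 'I_k -> 'rV[int]_n),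
    sigma = [set u | exists t : 'I_k -> R,
               (forall j, 0 <= t j) /\
               u = \sum_j t j *: lattice_point (v j)].

Definition strongly_convex sigma : Prop :=
  forall u, sigma u -> sigma (- u) -> u = 0.

Definition face tau sigma : Prop :=
  exists m : 'rV[R]_n,
    (forall u, sigma u -> 0 <= pairing m u) /\
    tau = [set u | sigma u /\ pairing m u = 0].

Definition rational_fan Sigma : Prop :=
  [/\ finite_set Sigma,
      forall sigma, Sigma sigma ->
        rational_polyhedral sigma /\ strongly_convex sigma,
      forall sigma tau, Sigma sigma -> face tau sigma -> Sigma tau &
      forall sigma sigma', Sigma sigma -> Sigma sigma' ->
        face (sigma `&` sigma') sigma /\ face (sigma `&` sigma') sigma'].

Definition is_ray sigma : Prop :=
  exists2 b : 'rV[int]_n, b != 0 &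
    sigma = [set t *: lattice_point b | t in [set t : R | 0 <= t]].

Definition dual_monoid sigma : set 'rV[int]_n :=
  [set m | forall u, sigma u -> 0 <= pairing (lattice_point m) u].

Definition orthogonal sigma : set 'rV[int]_n :=
  [set m | forall u, sigma u -> pairing (lattice_point m) u = 0].

End RationalFans.

Definition primitive n (b : 'rV[int]_n) : Prop :=
  forall (k : int) (c : 'rV[int]_n), b = k *: c -> `|k| = 1.

Section RealToricVariety.
Context {R : realType} {n : nat}.
Implicit Types (sigma : set 'rV[R]_n) (Sigma : set (set 'rV[R]_n)).

(* The real points of Spec C[S], that is the monoid morphisms from S to the
   multiplicative monoid R, for S = dual_monoid sigma.  Such a morphism is
   encoded as a function on the whole lattice, with the value 0 outside S.  The
   topology is that of pointwise convergence; as S is finitely generated, it is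
   the one induced from R^k by the values at k generators of S. *)
Definition affine_points sigma : set {ptws 'rV[int]_n -> R} :=
  [set x | [/\ x 0 = 1,
               forall m m', dual_monoid sigma m -> dual_monoid sigma m' ->
                 x (m + m') = x m * x m' &
               forall m, ~ dual_monoid sigma m -> x m = 0]].

Notation affine_pieces Sigma :=
  {sigma : Sigma & set_type (affine_points (val sigma))}.

(* A point of the piece of sigma and a point of the piece of sigma' are glued
   when they come from one point of the piece of their intersection. *)
Definition glued Sigma (p q : affine_pieces Sigma) : Prop :=
  exists z : affine_points (val (projT1 p) `&` val (projT1 q)),
    (forall m, dual_monoid (val (projT1 p)) m ->
       val (projT2 p) m = val z m) /\
    (forall m, dual_monoid (val (projT1 q)) m ->
       val (projT2 q) m = val z m).

(* For a fan, glued is already an equivalence relation; taking the generated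
   equivalence relation makes the quotient available for an arbitrary Sigma. *)
Definition glue_rel Sigma : rel (affine_pieces Sigma) :=
  fun p q => `[< clos_refl_sym_trans _ (@glued Sigma) p q >].

Lemma glue_rel_refl Sigma : reflexive (@glue_rel Sigma).
Proof. by move=> p; apply/asboolP; exact: rst_refl. Qed.

Lemma glue_rel_sym Sigma : symmetric (@glue_rel Sigma).
Proof. by move=> p q; apply: asbool_equiv_eq; split; exact: rst_sym. Qed.

Lemma glue_rel_trans Sigma : transitive (@glue_rel Sigma).
Proof.
move=> q p r /asboolP pq /asboolP qr; apply/asboolP.
exact: rst_trans pq qr.
Qed.

Definition glue_equiv Sigma : equiv_rel (affine_pieces Sigma) :=
  EquivRel _ (@glue_rel_refl Sigma) (@glue_rel_sym Sigma)
    (@glue_rel_trans Sigma).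

Definition real_toric_variety Sigma : Type := {eq_quot (glue_equiv Sigma)}.

HB.instance Definition _ Sigma :=
  Topological.copy (real_toric_variety Sigma)
    (quotient_topology {eq_quot (glue_equiv Sigma)}).
HB.instance Definition _ Sigma := Quotient.on (real_toric_variety Sigma).

Definition affine_inclusion Sigma (sigma : Sigma)
    (x : affine_points (val sigma)) : real_toric_variety Sigma :=
  \pi_(real_toric_variety Sigma) (existT _ sigma x : affine_pieces Sigma).

(* The orbit of sigma is the closed one in the affine piece of sigma: there the
   characters that do not vanish are those orthogonal to sigma. *)
Definition orbit_points Sigma (sigma : Sigma) : set (real_toric_variety Sigma) :=
  [set affine_inclusion x | x in
     [set x : affine_points (val sigma) |
        forall m, dual_monoid (val sigma) m ->
          (val x m != 0 <-> orthogonal (val sigma) m)]].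

Definition dim_le1 sigma : Prop := sigma = [set 0] \/ is_ray sigma.

(* The union of the orbits of codimension at most 1. *)
Definition toric_open_part Sigma : set (real_toric_variety Sigma) :=
  \bigcup_(sigma in [set sigma : Sigma | dim_le1 (val sigma)])
    orbit_points sigma.

End RealToricVariety.

Section Orientability.
Context {R : realType} {n : nat}.

Fixpoint Ck_on (k : nat) (O : set 'rV[R]_n) (f : 'rV[R]_n -> 'rV[R]_n) : Prop :=
  if k is k'.+1 then
    (forall x, O x -> differentiable f x) /\
    (forall v : 'rV[R]_n, Ck_on k' O (fun x => 'D_v f x))
  else forall x, O x -> {for x, continuous f}.

Definition smooth_on (O : set 'rV[R]_n) (f : 'rV[R]_n -> 'rV[R]_n) : Prop :=
  forall k, Ck_on k O f.

(* The values of coord outside dom are irrelevant. *)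
Record chart (X : Type) := Chart { dom : set X; coord : X -> 'rV[R]_n }.

Variable X : topologicalType.
Implicit Types (c : chart X) (A B : set (chart X)) (M W : set X).

Definition chart_in W c : Prop :=
  [/\ open (dom c), dom c `<=` W, {in dom c &, injective (coord c)},
      forall p, dom c p -> {for p, continuous (coord c)} &
      forall V, open V -> V `<=` dom c -> open (coord c @` V)].

(* When c is a chart, the domain below is open and the conditions determine f
   on it. *)
Definition smooth_transition c c' (f : 'rV[R]_n -> 'rV[R]_n) : Prop :=
  (forall p, dom c p -> dom c' p -> f (coord c p) = coord c' p) /\
  smooth_on (coord c @` (dom c `&` dom c')) f.

Definition smoothly_compatible c c' : Prop :=
  (exists f, smooth_transition c c' f) /\ (exists f, smooth_transition c' c f).

Definition orientedly_compatible c c' : Prop :=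
  exists2 f, smooth_transition c c' f &
    forall p, dom c p -> dom c' p -> 0 < \det ('J f (coord c p)).

(* W carries an oriented atlas for the smooth structure given by the atlas A. *)
Definition has_oriented_atlas A W : Prop :=
  exists B : set (chart X),
    [/\ forall c, B c -> chart_in W c,
        forall p, W p -> exists2 c, B c & dom c p,
        forall c a, B c -> A a -> smoothly_compatible c a &
        forall c c', B c -> B c' -> orientedly_compatible c c'].

Definition orientable A M : Prop :=
  forall p, M p -> has_oriented_atlas A (connected_component M p).

End Orientability.

Section ToricAtlas.
Context {R : realType} {n : nat}.
Implicit Types (sigma : set 'rV[R]_n) (Sigma : set (set 'rV[R]_n)).

(* The rows of m form a basis of the lattice which identifies dual_monoid sigma
   with the product of a copy of nat for each i in I and of int for each other
   i; the affine toric variety of sigma is then the product of affine lines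
   (i in I) and punctured affine lines. *)
Definition adapted_basis sigma (m : 'M[int]_n) : Prop :=
  m \in unitmx /\
  exists I : {set 'I_n}, forall a : 'rV[int]_n,
    dual_monoid sigma (a *m m) <-> (forall i, i \in I -> 0 <= a 0 i).

Definition toric_chart Sigma (c : @chart R n (real_toric_variety Sigma)) : Prop :=
  exists (sigma : Sigma) (m : 'M[int]_n),
    [/\ dim_le1 (val sigma), adapted_basis (val sigma) m,
        dom c = range (@affine_inclusion R n Sigma sigma) &
        forall x : affine_points (val sigma),
          coord c (affine_inclusion x) = \row_i val x (row i m)].

(* The smooth structure of the open part: each cone of dimension at most 1 has
   adapted bases, so that these charts cover it. *)
Definition toric_atlas Sigma : set (@chart R n (real_toric_variety Sigma)) :=
  [set c | toric_chart c].

End ToricAtlas.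

Section SignVectors.
Variable n : nat.

(* The group {1, -1}^n is the set of integer vectors below, with the entrywise
   product. *)
Definition sign_vector (g : 'rV[int]_n) : Prop :=
  forall i, g 0 i = 1 \/ g 0 i = -1.

Definition sign_pow (v : 'rV[int]_n) : 'rV[int]_n := \row_i (-1) ^ v 0 i.

Definition sign_prod k (e : 'I_k -> 'rV[int]_n) (J : {set 'I_k}) : 'rV[int]_n :=
  \row_i \prod_(j in J) e j 0 i.

(* In a multiplicatively written vector space over Z/2, the linear combinations
   of a finite family are the products of its subfamilies. *)
Definition sign_basis k (e : 'I_k -> 'rV[int]_n) : Prop :=
  [/\ forall j, sign_vector (e j),
      forall g, sign_vector g -> exists J, g = sign_prod e J &
      forall J, sign_prod e J = const_mx 1 -> J = finset.set0].

End SignVectors.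

(* Main.v *)
Require Import Defs.
From HB Require Import structures.
From Stdlib Require Import Relations.Relation_Operators.
From mathcomp Require Import all_boot all_order all_algebra generic_quotient.
From mathcomp Require Import all_classical all_reals all_analysis.
From mathcomp Require Import ring lra zify.
Import Order.TTheory GRing.Theory Num.Theory.
Import numFieldNormedType.Exports.
Set Implicit Arguments.
Unset Strict Implicit.
Unset Printing Implicit Defensive.
Local Open Scope classical_set_scope.
Local Open Scope ring_scope.
Local Open Scope quotient_scope.

(* On each orthant of the real torus orient by s dx_1/x_1 ... dx_n/x_n with a
   sign s.  In the chart of a ray with primitive generator b, one of whose
   coordinates vanishes on the ray's orbit, this form has a simple pole there, and
   crossing the orbit leads from the orthant of signs e to that of e(-1)^b; hence
   the orientations of the two orthants agree across it if and only if s changes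
   sign.  An orientation of the open part is thus a sign function with
   s(e(-1)^b) = -s(e) for all b.  A functional h over F_2 which is 1 on all b
   provides one, s = (-1)^h; if there is none, then an odd number of the b sum to 0
   modulo 2, and going through the corresponding walls from the orthant of signs
   (1, ..., 1) comes back there with the opposite orientation.  Finally h is 1 on
   all b if and only if the b are sums of an odd number of elements of some basis,
   h being the parity of the number of summands. *)

(** * Sign vectors over F_2 *)

(** Two obstacles shape the proof. An equality in the quotient is a chain of gluings, possibly
    through pieces of cones of any dimension. It is controlled by an invariant of points: the point
    of a closed orbit of which a representative is the restriction. Likewise openness and continuity
    in the quotient are tested on all pieces, not only on those of dimension at most 1, so
    coordinates of a ray's chart must be expressed near points of larger pieces. The second obstacle
    is the pole along the walls. A monomial change of coordinates with exponent matrix A multiplies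
    dx_1/x_1 ... dx_n/x_n by det A = 1 or -1, but this says nothing where a coordinate vanishes.
    Charts of distinct cones meet only inside the torus, where the formula applies. For a single
    cone the oriented atlas uses one fixed lattice basis, and charts that meet then have the
    identity as transition. Where the density is negative the first coordinate is reversed; for n =
    0 there is none to reverse, but the density is then 1. *)

Definition sgF2 (u : 'F_2) : int := (-1) ^+ (val u).

Lemma sgF2D u v : sgF2 (u + v) = sgF2 u * sgF2 v.
Proof. by move: u v => [[|[|//]] ?] [[|[|//]] ?]. Qed.

Lemma sgF2_inj : injective sgF2.
Proof. by move=> [[|[|//]] ?] [[|[|//]] ?] // _; apply/val_inj. Qed.

Lemma sgF2_sum (I : finType) (P : pred I) (F : I -> 'F_2) :
  sgF2 (\sum_(i | P i) F i) = \prod_(i | P i) sgF2 (F i).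
Proof. by apply: (big_morph _ sgF2D). Qed.

Lemma sgF2_int (z : int) : sgF2 z%:~R = (-1) ^ z.
Proof.
have nat_case (k : nat) : sgF2 k%:R = (-1) ^+ k.
  by elim: k => // k IH; rewrite -natr1 sgF2D IH exprSr.
case: z => k; first exact: nat_case.
have -> : (Negz k)%:~R = k.+1%:R :> 'F_2.
  rewrite NegzE mulrNz -[_.+1%:~R]/(_.+1%:R).
  by move: (k.+1%:R : 'F_2) => [[|[|//]] ?]; apply/val_inj.
by rewrite nat_case -[RHS]/(((-1) ^+ k.+1)^-1) -exprVn invrN1.
Qed.

Lemma F2_neq0 (u : 'F_2) : u != 0 -> u = 1.
Proof. by move: u => [[|[|//]] ?] // _; apply/val_inj. Qed.

Lemma F2_boolE (u : 'F_2) : u = (u != 0)%:R.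
Proof. by case: eqVneq => [->|/F2_neq0 ->]. Qed.

Lemma F2_nat_odd (k : nat) : (k%:R : 'F_2) = (odd k)%:R.
Proof.
rewrite -[in LHS](odd_double_half k) natrD -mul2n natrM.
by rewrite (_ : 2%:R = 0) ?mul0r ?addr0 //; apply/val_inj.
Qed.

Definition setF2 k (J : {set 'I_k}) : 'rV['F_2]_k := \row_j (j \in J)%:R.

Definition modF2 n (b : 'rV[int]_n) : 'rV['F_2]_n := map_mx intr b.

Definition sgvF2 n (u : 'rV['F_2]_n) : 'rV[int]_n := map_mx sgF2 u.

Lemma sgvF2_inj n : injective (@sgvF2 n).
Proof.
by move=> u v /rowP uv; apply/rowP => i; have := uv i; rewrite !mxE => /sgF2_inj.
Qed.

Lemma sign_powE n (b : 'rV[int]_n) : sign_pow b = sgvF2 (modF2 b).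
Proof. by apply/rowP => i; rewrite !mxE sgF2_int. Qed.

Lemma setF2_surj k (u : 'rV['F_2]_k) : exists J : {set 'I_k}, u = setF2 J.
Proof.
exists [set j | u 0 j != 0]%SET; apply/rowP => j.
by rewrite !mxE inE -F2_boolE.
Qed.

Lemma setF2_card k (J : {set 'I_k}) :
  (setF2 J *m const_mx 1 : 'M['F_2]_1) = (#|J|%:R)%:M.
Proof.
apply/matrixP => i j; rewrite !ord1 !mxE eqxx mulr1n.
under eq_bigr do rewrite !mxE mulr1.
by rewrite -sumr_const [RHS]big_mkcond /=; apply: eq_bigr => l _; case: (l \in J).
Qed.

Lemma sgvF2_sign n (u : 'rV['F_2]_n) : sign_vector (sgvF2 u).
Proof. by move=> i; rewrite mxE /sgF2;
  case: (odd (u 0 i)) (signr_odd int (u 0 i)) => <-; [right|left]. Qed.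

Lemma sign_vectorP n (g : 'rV[int]_n) :
  sign_vector g -> exists u, g = sgvF2 u.
Proof.
move=> sg; exists (\row_i (g 0 i == -1)%:R); apply/rowP => i; rewrite !mxE.
by case: (sg i) => ->.
Qed.

Lemma sign_prodE n k (E : 'M['F_2]_(k, n)) (J : {set 'I_k}) :
  sign_prod (fun j => sgvF2 (row j E)) J = sgvF2 (setF2 J *m E).
Proof.
apply/rowP => i; rewrite !mxE sgF2_sum big_mkcond /=; apply: eq_bigr => j _.
by rewrite !mxE; case: (j \in J); rewrite ?mul1r ?mul0r.
Qed.

Lemma const1_sgvF2 n : const_mx 1 = sgvF2 (0 : 'rV_n).
Proof. by apply/rowP => i; rewrite !mxE. Qed.

Lemma setF2_eq0 k (J : {set 'I_k}) : setF2 J = 0 -> J = finset.set0.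
Proof.
move=> J0; apply/setP => j; rewrite inE.
by have /rowP/(_ j) := J0; rewrite !mxE; case: (j \in J).
Qed.

Lemma setF20 k : setF2 (finset.set0 : {set 'I_k}) = 0.
Proof. by apply/rowP => j; rewrite !mxE inE. Qed.

(** The two sides are exchanged by the functional that sums the coordinates in the basis.
    Conversely, a nonzero functional has a basis on which it is constantly 1. *)
Lemma sign_basis_odd_functional n (P : set 'rV[int]_n) :
  (exists k (e : 'I_k -> 'rV[int]_n), sign_basis e /\
     forall b, P b -> exists J : {set 'I_k},
       odd #|J| /\ sign_pow b = sign_prod e J) <->
  exists c : 'cV['F_2]_n, forall b, P b -> modF2 b *m c = 1%:M.
Proof.
split=> [[k [e [[se ge ie] Pe]]]|[c Pc]].
  have /choice[E eE] : forall j, exists u, e j = sgvF2 u.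
    by move=> j; apply: sign_vectorP.
  pose A := \matrix_j E j; have {eE} eE : e = fun j => sgvF2 (row j A).
    by apply: funext => j; rewrite rowK.
  rewrite {}eE in se ge ie Pe.
  have /row_freeP[B AB] : row_free A.
    apply: inj_row_free => u uA; have [J uJ] := setF2_surj u.
    rewrite uJ (ie J) ?setF20 //.
    by rewrite sign_prodE -uJ uA const1_sgvF2.
  (* [B] turns a vector into its coordinates in the basis, and [const_mx 1] sums them. *)
  exists (B *m const_mx 1) => b /Pe[J [oJ]].
  rewrite sign_powE sign_prodE => /sgvF2_inj ->.
  rewrite -mulmxA (mulmxA A) AB mul1mx setF2_card F2_nat_odd oJ.
  by [].
(* The zero functional never takes the value 1, so [P] is then empty and any basis will do. *)
have [c0|/cV0Pn[i0 /F2_neq0 ci0]] := eqVneq c 0.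
  have PF b : ~ P b.
    move=> /Pc; rewrite c0 mulmx0 => /matrixP/(_ 0 0).
    by rewrite !mxE.
  exists n, (fun j => sgvF2 (row j 1%:M)); split; last by move=> b /PF.
  split=> [j|g /sign_vectorP[u ->]|J].
  - exact: sgvF2_sign.
  - by have [J ->] := setF2_surj u; exists J; rewrite sign_prodE mulmx1.
  - by rewrite sign_prodE mulmx1 const1_sgvF2 => /sgvF2_inj/setF2_eq0.
(* Since [c] is 1 at [i0], this is a transvection taking the column [c] to the constant column 1:
   [c] is 1 on every row of [E]. In characteristic 2 it is an involution, so its rows form a
   basis. *)
pose E : 'M['F_2]_n := 1%:M + (const_mx 1 - c) *m delta_mx 0 i0.
have Ec : E *m c = const_mx 1.
  rewrite mulmxDl mul1mx -mulmxA.
  have -> : (delta_mx 0 i0 : 'rV_n) *m c = 1%:M.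
    by rewrite -rowE; apply/rowP => j; rewrite !mxE !ord1 ci0.
  by rewrite mulmx1 addrC subrK.
have EE : E *m E = 1%:M.
  rewrite mulmxDr mulmx1 mulmxA mulmxBr Ec.
  have -> : E *m const_mx 1 = c.
    rewrite mulmxDl mul1mx -mulmxA.
    have -> : (delta_mx 0 i0 : 'rV_n) *m const_mx 1 = 1%:M :> 'M['F_2]_1.
      by rewrite -rowE; apply/rowP => j; rewrite !mxE !ord1.
    rewrite mulmx1; apply/colP => j; rewrite !mxE.
    by case: (c j 0) => [[|[|//]] ?]; apply/val_inj.
  rewrite /E -addrA -mulmxDl.
  have -> : const_mx 1 - c + (c - const_mx 1) = 0 by rewrite addrC addrA subrK subrr.
  by rewrite mul0mx addr0.
clearbody E.
have rep u : exists J : {set 'I_n}, sgvF2 u = sign_prod (fun j => sgvF2 (row j E)) J /\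
    (#|J|%:R)%:M = (u *m c : 'M['F_2]_1).
  have [J uJ] := setF2_surj (u *m E).
  exists J; rewrite sign_prodE -uJ -mulmxA EE mulmx1; split=> //.
  by rewrite -setF2_card -uJ -mulmxA -Ec (mulmxA E E) EE mul1mx.
exists n, (fun j => sgvF2 (row j E)); split.
  split=> [j|g /sign_vectorP[u ->]|J].
  - exact: sgvF2_sign.
  - by have [J [-> _]] := rep u; exists J.
  - rewrite sign_prodE const1_sgvF2 => /sgvF2_inj/(congr1 (mulmx^~ E)).
    by rewrite mul0mx -mulmxA EE mulmx1 => /setF2_eq0.
move=> b Pb; have [J [bJ cJ]] := rep (modF2 b).
exists J; rewrite sign_powE; split=> //.
have : (#|J|%:R)%:M = 1%:M :> 'M['F_2]_1 by rewrite cJ Pc.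
by rewrite F2_nat_odd => /matrixP/(_ 0 0); rewrite !mxE; case: (odd _).
Qed.

(* The Fredholm alternative; P is infinite in general but has finitely many
   residues modulo 2. *)
Lemma odd_functional_or_relation n (P : set 'rV[int]_n) :
  (exists c : 'cV['F_2]_n, forall b, P b -> modF2 b *m c = 1%:M) \/
  exists s : seq 'rV[int]_n, [/\ forall b, b \in s -> P b, odd (size s) &
    \sum_(b <- s) modF2 b = 0].
Proof.
pose S : {set 'rV['F_2]_n} := [set u | `[< exists2 b, P b & modF2 b = u >]]%SET.
pose A : 'M['F_2]_(#|S|, n) := \matrix_j enum_val j.
have [/submxP[D DA]|] := boolP ((const_mx 1 : 'rV['F_2]_#|S|) <= A^T)%MS.
  left; exists D^T => b Pb.
  have bS : modF2 b \in S by rewrite inE; apply/asboolP; exists b.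
  have -> : modF2 b = row (enum_rank_in bS (modF2 b)) A by rewrite rowK enum_rankK_in.
  rewrite -row_mul -[A]trmxK -trmx_mul -DA trmx_const.
  by apply/matrixP => i j; rewrite !mxE !ord1.
rewrite submxE => /rV0Pn[j Aj]; right.
have /choice[g Pg] : forall i : 'I_#|S|, exists b, P b /\ modF2 b = enum_val i.
  move=> i; have := enum_valP i; rewrite inE => /asboolP[b Pb <-].
  by exists b.
(* This column is killed by [A^T] but not by the row of ones, so it is the indicator of an odd set
   of residues with sum 0. *)
pose u := col j (cokermx A^T).
have [J uJ] := setF2_surj u^T.
exists [seq g i | i <- enum J]; split.
- by move=> b /mapP[i _ ->]; case: (Pg i).
- rewrite size_map -cardE.
  have: (setF2 J *m const_mx 1 : 'M['F_2]_1) 0 0 != 0.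
    suff -> : (setF2 J *m const_mx 1 : 'M['F_2]_1) 0 0 =
      ((const_mx 1 : 'rV['F_2]_#|S|) *m cokermx A^T) 0 j by [].
    rewrite -uJ [LHS]mxE [RHS]mxE; apply: eq_bigr => i _.
    by rewrite !mxE mulrC.
  by rewrite setF2_card mxE eqxx mulr1n F2_nat_odd; case: odd.
- rewrite big_map big_enum /=.
  have : u^T *m A = 0.
    by rewrite -[A]trmxK -trmx_mul /u colE mulmxA mulmx_coker mul0mx trmx0.
  rewrite uJ mulmx_sum_row => JA0; rewrite -[RHS]JA0 big_mkcond /=.
  apply: eq_bigr => i _.
  by rewrite !mxE rowK; case: (Pg i) => _ ->; case: (i \in J);
    rewrite ?scale1r ?scale0r.
Qed.

(** * Smooth monomial maps and their Jacobians *)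

Lemma cvg_mx_entries {T : topologicalType} m n {S : Type} (F : set_system S)
    (f : S -> 'M[T]_(m, n)) (M : 'M[T]_(m, n)) : Filter F ->
  (forall i j, f x i j @[x --> F] --> M i j) -> f x @[x --> F] --> M.
Proof.
move=> FF fM A [P MP PA]; apply: (@filterS _ _ _ _ _ PA).
have : \forall x \near F, forall ij : 'I_m * 'I_n, P ij.1 ij.2 (f x ij.1 ij.2).
  by apply: filter_forall => -[i j]; exact: (fM i j).
by apply: filterS => x Px i j; exact: (Px (i, j)).
Qed.

Lemma near_eq_continuous_at {T U : topologicalType} (f g : T -> U) (x : T) :
  {near x, f =1 g} -> {for x, continuous f} -> {for x, continuous g}.
Proof.
move=> fg fx; rewrite /prop_for /continuous_at -(nbhs_singleton fg).
exact: cvg_trans (near_eq_cvg fg) fx.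
Qed.

Lemma near_eq_differentiable {R : numFieldType} {V W : normedModType R} (f g : V ->
  W) (x : V) :
  {near x, f =1 g} -> differentiable f x ->
  differentiable g x.
Proof.
move=> fg df; have dfc : continuous ('d f x) by exact: diff_continuous.
have E : g \o shift x = cst (g x) + 'd f x +o_ 0 id.
  have := diff_locally df; rewrite -(nbhs_singleton fg) => /eqaddoP fo.
  apply/eqaddoP => e e0; have := fo e e0; apply: filter_app.
  have : \forall h \near (0 : V), f (h + x) = g (h + x).
    by have := fg; rewrite (near_shift 0 x) subr0.
  by apply: filterS => h; rewrite /= !fctE /= => ->.
have dgf := @diff_unique R V W g ('d f x) x dfc E.
by apply/diff_locallyP; rewrite dgf.
Qed.

Section Jacobian.
Context {R : numFieldType} {n : nat}.
Implicit Types (f g : 'rV[R]_n -> 'rV[R]_n) (y : 'rV[R]_n).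
Lemma jacobian_comp f g y :
  differentiable f y -> differentiable g (f y) ->
  'J (g \o f) y = 'J f y *m 'J g (f y).
Proof.
move=> df dg; have dgf := differentiable_comp df dg.
apply/row_matrixP => i.
rewrite (rowE i ('J (g \o f) y)) (row_mul i ('J f y)) (rowE i ('J f y)).
apply: (etrans (esym (deriveEjacobian (delta_mx 0 i) dgf))).
apply: (etrans (deriveE _ dgf)).
apply: (etrans (congr1 (fun h => h (delta_mx 0 i)) (diff_comp df dg))).
apply: (etrans (esym (deriveE _ dg))).
apply: (etrans (deriveEjacobian _ dg)); congr (_ *m _).
apply: (etrans (esym (deriveE _ df))).
exact: (deriveEjacobian _ df).
Qed.
Lemma jacobian_id y : 'J (@id 'rV[R]_n) y = 1%:M.
Proof.
have di : differentiable (@id 'rV[R]_n) y by apply: ex_diff.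
apply/row_matrixP => i; rewrite (rowE i ('J id y)).
apply: (etrans (esym (deriveEjacobian (delta_mx 0 i) di))).
by rewrite derive_id rowE mulmx1.
Qed.

Lemma near_eq_jacobian f g y :
  {near y, f =1 g} -> differentiable f y -> 'J g y = 'J f y.
Proof.
move=> fg df; have dg : differentiable g y by exact: near_eq_differentiable fg df.
apply/row_matrixP => i; apply: (etrans (rowE i ('J g y))).
apply: (etrans _ (esym (rowE i ('J f y)))).
apply: (etrans (esym (deriveEjacobian (delta_mx 0 i) dg))).
apply: (etrans _ (deriveEjacobian (delta_mx 0 i) df)).
by apply/esym/near_eq_derive.
Qed.

End Jacobian.

Section RegularFunctions.
Context {R : realType} {n : nat}.
Implicit Types (O : set 'rV[R]_n) (g : 'rV[R]_n -> R) (y v : 'rV[R]_n).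

(* The ring generated by the coordinates and the inverses of those which do not
   vanish on O; it is stable under directional derivatives. *)
Inductive regular_on O : ('rV[R]_n -> R) -> Prop :=
| regular_cst c : regular_on O (fun=> c)
| regular_coord j : regular_on O (fun y => y 0 j)
| regular_inv j : (forall y, O y -> y 0 j != 0) ->
    regular_on O (fun y => (y 0 j)^-1)
| regular_add g h : regular_on O g -> regular_on O h ->
    regular_on O (fun y => g y + h y)
| regular_mul g h : regular_on O g -> regular_on O h ->
    regular_on O (fun y => g y * h y).

Lemma regular_differentiable O g y :
  regular_on O g -> O y -> differentiable g y.
Proof.
move=> rg Oy; elim: rg => [c|j|j Oj|{}g h _ dg _ dh|{}g h _ dg _ dh].
- exact: differentiable_cst.
- exact: differentiable_coord.
- by apply: differentiableV; [exact: differentiable_coord|exact: Oj].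
- exact: differentiableD.
- exact: differentiableM.
Qed.

Lemma derive_coord v y j : 'D_v (fun z : 'rV[R]_n => z 0 j) y = v 0 j.
Proof.
have := @derive_mx R _ 1 n id y v (@derivable_id _ _ y v); rewrite derive_id.
by move=> /matrixP/(_ 0 j); rewrite mxE => <-.
Qed.

Lemma regular_derive O g v : regular_on O g ->
  exists2 g', regular_on O g' & forall y, O y -> 'D_v g y = g' y.
Proof.
elim=> [c|j|j Oj|{}g h rg [g' rg' gg'] rh [h' rh' hh']|{}g h rg [g' rg' gg'] rh [h'
  rh' hh']].
- exists (fun=> 0); first exact: regular_cst.
  by move=> y _; exact: derive_cst.
- exists (fun=> v 0 j); first exact: regular_cst.
  by move=> y _; exact: derive_coord.
- exists (fun y => - v 0 j * ((y 0 j)^-1 * (y 0 j)^-1)).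
    by do !apply: regular_mul; [exact: regular_cst|exact: regular_inv..].
  move=> y Oy; rewrite deriveV ?Oj//; last exact/diff_derivable/differentiable_coord.
  by rewrite derive_coord /GRing.scale /= -invfM -expr2 !mulNr mulrC.
- exists (fun y => g' y + h' y); first exact: regular_add.
  move=> y Oy; have D f rf := @diff_derivable _ _ _ _ _ v (@regular_differentiable O
    f y rf Oy).
  by rewrite [LHS](deriveD (D _ rg) (D _ rh)) gg' ?hh'.
- exists (fun y => g y * h' y + h y * g' y).
    by apply: regular_add; apply: regular_mul.
  move=> y Oy; have D f rf := @diff_derivable _ _ _ _ _ v (@regular_differentiable O
    f y rf Oy).
  by rewrite [LHS](deriveM (D _ rg) (D _ rh)) gg' ?hh'.
Qed.

Lemma differentiable_entries (f : 'rV[R]_n -> 'rV[R]_n) y :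
  (forall j, differentiable (fun z => f z 0 j) y) -> differentiable f y.
Proof.
move=> df.
have -> : f = \sum_j (fun z => f z 0 j *: delta_mx 0 j).
  by apply/funext => z; rewrite fct_sumE; exact: row_sum_delta.
by apply: differentiable_sum => j; exact: differentiableZl.
Qed.

(** Agreement with regular functions is asked on [O] only, because derivatives are known to be
    regular only there; this makes the hypothesis pass to ['D_v f] in the induction on [k]. *)
Lemma regular_Ck k O (f : 'rV[R]_n -> 'rV[R]_n) : open O ->
  (forall j, exists2 g, regular_on O g & forall y, O y -> f y 0 j = g y) ->
  Ck_on k O f.
Proof.
move=> oO; elim: k f => [|k IH] f rf.
  move=> y Oy; apply: (@cvg_mx_entries _ 1 n _ (nbhs y) f (f y)) => i j; rewrite ord1.
  have [g rg fg] := rf j; rewrite (fg _ Oy).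
  have /differentiable_continuous gc := regular_differentiable rg Oy.
  apply: cvg_trans gc; apply: near_eq_cvg.
  by have : \forall z \near y, O z by [exact: open_nbhs_nbhs]; apply: filterS => z /fg.
have df y : O y -> differentiable f y.
  move=> Oy; apply: differentiable_entries => j; have [g rg fg] := rf j.
  apply: (near_eq_differentiable _ (regular_differentiable rg Oy)).
  by have : \forall z \near y, O z by [exact: open_nbhs_nbhs]; apply: filterS => z /fg.
split=> [//|v]; apply: IH => j; have [g rg fg] := rf j.
have [g' rg' gg'] := regular_derive v rg; exists g' => // y Oy.
rewrite -gg' // derive_mx ?mxE; last exact/diff_derivable/df.
apply: near_eq_derive.
by have : \forall z \near y, O z by [exact: open_nbhs_nbhs]; apply: filterS => z /fg.
Qed.

Lemma regular_smooth O (f : 'rV[R]_n -> 'rV[R]_n) : open O ->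
  (forall j, exists2 g, regular_on O g & forall y, O y -> f y 0 j = g y) ->
  smooth_on O f.
Proof. by move=> oO rf k; exact: regular_Ck. Qed.

Lemma regular_big_mul O (I : Type) (r : seq I) (F : I -> 'rV[R]_n -> R) :
  (forall i, regular_on O (F i)) -> regular_on O (fun y => \prod_(i <- r) F i y).
Proof.
move=> rF; elim: r => [|i r IH].
  by under eq_fun do rewrite big_nil; exact: regular_cst.
by under eq_fun do rewrite big_cons; exact: regular_mul.
Qed.

Lemma regular_exp O g k : regular_on O g -> regular_on O (fun y => g y ^+ k).
Proof.
move=> rg; elim: k => [|k IH]; first exact: regular_cst.
by under eq_fun do rewrite exprS; exact: regular_mul.
Qed.

(** A Laurent monomial, made total by the convention that the inverse of 0 is 0. *)
Definition monomial (a : 'rV[int]_n) y : R := \prod_j y 0 j ^ a 0 j.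

Lemma regular_monomial O (a : 'rV[int]_n) :
  (forall j, 0 <= a 0 j \/ forall y, O y -> y 0 j != 0) ->
  regular_on O (monomial a).
Proof.
move=> aO; apply: regular_big_mul => j.
case: (a 0 j) (aO j) => k; first by move=> _; exact/regular_exp/regular_coord.
case=> // Oj; rewrite (_ : (fun y => _) = (fun y => (y 0 j)^-1 ^+ k.+1)).
  exact/regular_exp/regular_inv.
by apply/funext => y; rewrite exprVn.
Qed.

(** In logarithmic form the derivative has one expression for both signs of [z]. *)
Lemma is_derive_exprz (V : normedModType R) (g : V -> R) (x v : V) dg (z : int) :
  g x != 0 -> is_derive x v g dg ->
  is_derive x v (fun t => g t ^ z) (z%:~R * dg / g x * g x ^ z).
Proof.
move=> gx Dg.
have dX k : is_derive x v (g ^+ k) (k%:R * dg / g x * g x ^+ k).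
  apply: (is_derive_eq (is_deriveX k Dg)).
  case: k => [|k]; first by rewrite !(mul0r, scale0r).
  by rewrite /GRing.scale /= exprS; field; exact: gx.
case: z => k.
  by have := dX k; rewrite exprfctE.
have gxk : (g ^+ k.+1) x != 0 by rewrite exprfctE expf_neq0.
have -> : (fun t => g t ^ Negz k) = (fun t => ((g ^+ k.+1) t)^-1).
  by apply/funext => t; rewrite exprfctE.
have [dk ek] := dX k.+1.
apply: DeriveDef; first exact: derivableV.
rewrite (deriveV gxk dk) ek exprfctE /GRing.scale /=.
rewrite -[g x ^ Negz k]/((g x ^+ k.+1)^-1).
rewrite NegzE mulrNz -[k.+1%:~R]/(k.+1%:R : R).
by field; rewrite gx expf_neq0.
Qed.

Lemma is_derive_monomial v y (a : 'rV[int]_n) : (forall j, y 0 j != 0) ->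
  is_derive y v (monomial a)
    ((\sum_j (a 0 j)%:~R * v 0 j / y 0 j) * monomial a y).
Proof.
move=> y0; rewrite /monomial; elim: (index_enum _) => [|j r IH].
  under eq_fun do rewrite big_nil.
  by rewrite !big_nil mul0r; exact: is_derive_cst.
under eq_fun do rewrite big_cons.
have dj : is_derive y v (fun x => x 0 j) (v 0 j).
  apply: DeriveDef; last exact: derive_coord.
  exact/diff_derivable/differentiable_coord.
apply: (is_derive_eq (is_deriveM (is_derive_exprz (a 0 j) (y0 j) dj) IH)).
rewrite !big_cons /GRing.scale /=.
by rewrite mulrDl addrC mulrCA !mulrA; congr (_ + _); ring.
Qed.

(* The coordinate changes of the toric atlas, up to a rescaling of the
   coordinates. *)
Definition monomial_map (A : 'M[int]_n) (u : 'rV[R]_n) y : 'rV[R]_n :=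
  \row_i (u 0 i * monomial (row i A) y).

Lemma smooth_monomial_map O (A : 'M[int]_n) (u : 'rV[R]_n) : open O ->
  (forall i j, 0 <= A i j \/ forall y, O y -> y 0 j != 0) ->
  smooth_on O (monomial_map A u).
Proof.
move=> oO AO; apply: regular_smooth => // j.
exists (fun y => u 0 j * monomial (row j A) y); last by move=> y _; rewrite mxE.
apply: regular_mul; first exact: regular_cst.
by apply: regular_monomial => l; rewrite mxE.
Qed.

Lemma jacobian_entry (f : 'rV[R]_n -> 'rV[R]_n) y i j : differentiable f y ->
  ('J f y) i j = ('D_(delta_mx 0 i) f y) 0 j.
Proof. by move=> df; rewrite deriveE // mxE. Qed.

(** In logarithmic coordinates the map is affine with linear part [A]. The product of quotients
    converts between the forms dx_j and dx_j/x_j at source and target. *)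
Lemma det_jacobian_monomial_map (A : 'M[int]_n) (u : 'rV[R]_n) y : (forall j, y 0 j
  != 0) ->
  \det ('J (monomial_map A u) y) =
  (\det A)%:~R * \prod_j (monomial_map A u y 0 j / y 0 j).
Proof.
move=> y0.
have dm a : differentiable (monomial a) y.
  apply: (@regular_differentiable [set z | forall j, z 0 j != 0]) => //.
  by apply: regular_monomial => j; right=> z; apply.
have df : differentiable (monomial_map A u) y.
  apply: differentiable_entries => j; under eq_fun do rewrite mxE.
  by apply: differentiableM.
have -> : 'J (monomial_map A u) y = diag_mx (\row_j (y 0 j)^-1) *m
    (map_mx intr A)^T *m diag_mx (monomial_map A u y).
  apply/matrixP => i j; rewrite jacobian_entry // mul_mx_diag mul_diag_mx !mxE.
  rewrite derive_mx ?mxE; last exact: diff_derivable.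
  under eq_fun do rewrite mxE.
  have /@derive_val := is_deriveM (is_derive_cst (u 0 j) y (delta_mx 0 i))
    (is_derive_monomial (delta_mx 0 i) (row j A) y0).
  rewrite /= => ->; rewrite /GRing.scale /= mulr0 addr0 (bigD1 i) //= big1 ?addr0.
    by rewrite !mxE !eqxx mulr1; ring.
  by move=> l li; rewrite !mxE (negPf li) mulr0 mul0r.
rewrite !det_mulmx !det_diag det_tr det_map_mx big_split /=.
rewrite -mulrA mulrCA; congr (_ * _); rewrite mulrC; congr (_ * _).
by apply: eq_bigr => j _; rewrite mxE.
Qed.

Lemma continuous_det_jacobian O (f : 'rV[R]_n -> 'rV[R]_n) y : open O ->
  smooth_on O f -> O y -> {for y, continuous (fun z => \det ('J f z))}.
Proof.
move=> oO sf Oy; have [df Df] := sf 1.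
apply: (@near_eq_continuous_at _ _
  (fun z => \det (\matrix_(i, j) ('D_(delta_mx 0 i) f z) 0 j))).
  have : \forall z \near y, O z by exact: open_nbhs_nbhs.
  apply: filterS => z /df dz; congr (\det _); apply/matrixP => i j.
  by rewrite (jacobian_entry _ _ dz) mxE.
have cD i j : ('D_(delta_mx 0 i) f z) 0 j @[z --> y] --> ('D_(delta_mx 0 i) f y) 0 j.
  apply: (@cvg_comp _ _ _ (fun z => 'D_(delta_mx 0 i) f z)
    (fun M : 'rV[R]_n => M 0 j)); last exact: coord_continuous.
  by have := Df (delta_mx 0 i); apply.
rewrite /determinant /prop_for /continuous_at.
apply: (@cvg_big R _ +%R 0 _ _ _ (nbhs y)) => [|s _]; first exact: add_continuous.
apply: cvgM; first exact: cvg_cst.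
apply: (@cvg_big R _ *%R 1 _ _ _ (nbhs y)) => [|i _]; first exact: mul_continuous.
by under eq_cvg do rewrite mxE; rewrite mxE; exact: cD.
Qed.

End RegularFunctions.

(** * Faces and dual monoids of rational cones *)

Section Pairing.
Context {R : realType} {n : nat}.
Implicit Types (u v : 'rV[R]_n) (a b : 'rV[int]_n).

Lemma pairingDl u u' v : pairing (u + u') v = pairing u v + pairing u' v.
Proof. by rewrite /pairing -big_split; apply: eq_bigr => i _; rewrite mxE mulrDl. Qed.

Lemma pairingZl t u v : pairing (t *: u) v = t * pairing u v.
Proof. by rewrite /pairing mulr_sumr; apply: eq_bigr => i _; rewrite mxE mulrA. Qed.

Lemma pairingZr t u v : pairing u (t *: v) = t * pairing u v.
Proof. by rewrite /pairing mulr_sumr; apply: eq_bigr => i _; rewrite mxE mulrCA. Qed.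

Lemma pairing_sumr (I : finType) u (F : I -> 'rV[R]_n) :
  pairing u (\sum_j F j) = \sum_j pairing u (F j).
Proof.
rewrite /pairing exchange_big /=; apply: eq_bigr => i _.
by rewrite summxE mulr_sumr.
Qed.

Lemma pairing0l v : pairing 0 v = 0.
Proof. by rewrite -(scale0r 0) pairingZl mul0r. Qed.

Lemma pairing0r u : pairing u 0 = 0.
Proof. by rewrite -(scale0r 0) pairingZr mul0r. Qed.

Lemma lattice_pointD a b :
  lattice_point (a + b) = lattice_point a + lattice_point b :> 'rV[R]_n.
Proof. by apply/rowP => i; rewrite !mxE rmorphD. Qed.

Lemma lattice_pointZ (k : int) a :
  lattice_point (k *: a) = k%:~R *: lattice_point a :> 'rV[R]_n.
Proof. by apply/rowP => i; rewrite !mxE rmorphM. Qed.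

Lemma lattice_point0 : lattice_point 0 = 0 :> 'rV[R]_n.
Proof. by apply/rowP => i; rewrite !mxE. Qed.

Lemma lattice_point_inj : injective (@lattice_point R n).
Proof.
by move=> a b /rowP ab; apply/rowP => i; have := ab i; rewrite !mxE => /intr_inj.
Qed.

Lemma pairing_lattice a b :
  pairing (lattice_point a) (lattice_point b) = ((a *m b^T) 0 0)%:~R :> R.
Proof.
rewrite mxE rmorph_sum; apply: eq_bigr => i _.
by rewrite !mxE rmorphM.
Qed.

End Pairing.

Section DualMonoid.
Context {R : realType} {n : nat}.
Implicit Types (sigma tau : set 'rV[R]_n) (a b m : 'rV[int]_n).

Lemma dual_monoidD sigma a b :
  dual_monoid sigma a -> dual_monoid sigma b -> dual_monoid sigma (a + b).
Proof.
by move=> sa sb u su; rewrite lattice_pointD pairingDl addr_ge0 ?sa ?sb.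
Qed.

Lemma dual_monoid0 sigma : dual_monoid sigma 0.
Proof. by move=> u _; rewrite lattice_point0 pairing0l. Qed.

Lemma dual_monoidMn sigma a k : dual_monoid sigma a -> dual_monoid sigma (a *+ k).
Proof.
move=> sa; elim: k => [|k IH]; first exact: dual_monoid0.
by rewrite mulrSr; exact: dual_monoidD.
Qed.

Lemma dual_monoidS sigma tau a :
  tau `<=` sigma -> dual_monoid sigma a -> dual_monoid tau a.
Proof. by move=> ts sa u /ts; exact: sa. Qed.

Lemma dual_monoid_set0 a : dual_monoid [set (0 : 'rV[R]_n)] a.
Proof. by move=> u ->; rewrite pairing0r. Qed.

Lemma orthogonal_dual sigma a : Defs.orthogonal sigma a -> dual_monoid sigma a.
Proof. by move=> oa u su; rewrite oa. Qed.

Lemma orthogonalN sigma a : Defs.orthogonal sigma a -> Defs.orthogonal sigma (- a).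
Proof.
move=> oa u su; rewrite -scaleN1r lattice_pointZ pairingZl.
by rewrite (oa _ su) mulr0.
Qed.

Definition generated k (v : 'I_k -> 'rV[int]_n) : set 'rV[R]_n :=
  [set u | exists t : 'I_k -> R,
    (forall j, 0 <= t j) /\ u = \sum_j t j *: lattice_point (v j)].

Lemma generated_gen k (v : 'I_k -> 'rV[int]_n) j :
  generated v (lattice_point (v j)).
Proof.
exists (fun i => (i == j)%:R); split=> [i|]; first exact: ler0n.
rewrite (bigD1 j) //= eqxx scale1r big1 ?addr0 // => i /negPf ->.
exact: scale0r.
Qed.

Lemma generated_dual k (v : 'I_k -> 'rV[int]_n) a :
  (forall j, 0 <= (a *m (v j)^T) 0 0) -> dual_monoid (generated v) a.
Proof.
move=> av u [t [t0 ->]]; rewrite pairing_sumr sumr_ge0 // => j _.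
by rewrite pairingZr mulr_ge0 // pairing_lattice ler0z.
Qed.

Lemma clear_denominators (q : 'rV[rat]_n) :
  exists2 d : int, 0 < d & exists a : 'rV[int]_n, map_mx intr a = d%:~R *: q.
Proof.
exists (\prod_j denq (q 0 j)).
  by apply: prodr_gt0 => j _; exact: denq_gt0.
exists (\row_i (numq (q 0 i) * \prod_(j | j != i) denq (q 0 j))).
apply/rowP => i; rewrite !mxE [in RHS](bigD1 i) //= !intrM numqE.
by ring.
Qed.

(* A real functional vanishing on some integral vectors is a real combination of
   rational ones; perturbing the coefficients keeps the strict inequalities. *)
Lemma integral_functional k (v : 'I_k -> 'rV[int]_n) (m : 'rV[R]_n) :
  (forall j, 0 <= pairing m (lattice_point (v j))) ->
  exists a, forall j, 0 <= (a *m (v j)^T) 0 0 /\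
    ((a *m (v j)^T) 0 0 = 0 <-> pairing m (lattice_point (v j)) = 0).
Proof.
move=> mv; pose J j := pairing m (lattice_point (v j)) == 0.
(* The columns outside [J] are set to 0, so that the kernel imposes only the equalities satisfied by
   [m]. *)
pose V : 'M[rat]_(n, k) := \matrix_(i, j) ((v j 0 i)%:~R *+ J j).
pose K := kermx V.
have /submxP[c mc] : (m <= map_mx ratr K)%MS.
  rewrite /K map_kermx; apply/sub_kermxP; apply/rowP => j; rewrite !mxE.
  rewrite -[RHS](mul0rn _ (J j)).
  have [/eqP Jj|Jj] := boolP (J j); last first.
    rewrite mulr0n big1 // => i _.
    by rewrite !mxE (negPf Jj) mulr0n rmorph0 mulr0.
  rewrite mulr1n -[RHS]Jj; apply: eq_bigr => i _.
  by rewrite !mxE /J Jj eqxx mulr1n /= ratr_int.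
pose W (i : 'I_n) (j : 'I_k) : R := (map_mx ratr K *m (lattice_point (v j))^T) i 0.
have mW j : pairing m (lattice_point (v j)) = \sum_i c 0 i * W i j.
  transitivity ((m *m (lattice_point (v j))^T) 0 0).
    by rewrite mxE; apply: eq_bigr => i _; rewrite [in RHS]mxE.
  by rewrite mc -mulmxA mxE.
pose B j := \sum_i `|W i j|; pose A j := pairing m (lattice_point (v j)).
have B0 j : 0 <= B j by apply: sumr_ge0.
(* Moving each coefficient by less than [e] moves the value on [v j] by at most [e * B j]; the sum
   makes this smaller than [A j] for all strict inequalities at once. *)
pose e := (1 + \sum_(j | ~~ J j) B j / A j)^-1.
have S0 : 0 < 1 + \sum_(j | ~~ J j) B j / A j.
  by rewrite ltr_pwDl // sumr_ge0 // => j _; rewrite divr_ge0 ?mv.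
have e0 : 0 < e by rewrite invr_gt0.
have eB j : ~~ J j -> e * B j < A j.
  move=> Jj; have Aj : 0 < A j by rewrite lt_neqAle mv eq_sym andbT.
  rewrite /e mulrC ltr_pdivrMr // mulrC -ltr_pdivrMr //.
  rewrite (bigD1 j) //= addrCA ltrDl ltr_pwDl // sumr_ge0 // => l _.
  by rewrite divr_ge0 ?mv.
have /choice[d dc] : forall i, exists q : rat, `|ratr q - c 0 i| < e.
  move=> i; have [q] := @rat_in_itvoo R (c 0 i - e) (c 0 i + e) ltac:(lra).
  by rewrite in_itv /= => /andP[? ?]; exists q; rewrite ltr_norml; apply/andP; split;
    lra.
have [z z0 [a az]] := clear_denominators ((\row_i d i) *m K).
have aR : lattice_point a = z%:~R *: (map_mx ratr (\row_i d i) *m map_mx ratr K) :>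
  'rV[R]_n.
  rewrite -map_mxM; apply/rowP => i; have /rowP/(_ i) := az.
  rewrite !mxE => az_i. by rewrite -[(a 0 i)%:~R](ratr_int R) az_i rmorphM /= ratr_int.
have aW j : pairing (lattice_point a) (lattice_point (v j)) = z%:~R * \sum_i ratr (d
  i) * W i j :> R.
  rewrite aR pairingZl; congr (_ * _).
  transitivity ((map_mx ratr (\row_i d i) *m map_mx ratr K *m (@lattice_point R n (v
    j))^T) 0 0).
    by rewrite [RHS]mxE; apply: eq_bigr => i _; rewrite [X in _ = _ * X]mxE.
  by rewrite -mulmxA [LHS]mxE; apply: eq_bigr => i _; congr (_ * _); rewrite !mxE.
have zR : 0 < z%:~R :> R by rewrite ltr0z.
have SJ j : J j -> \sum_i ratr (d i) * W i j = 0.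
  move=> Jj; rewrite big1 // => i _; rewrite (_ : W i j = 0) ?mulr0 //.
  have : K *m V = 0 by rewrite mulmx_ker.
  move=> /matrixP/(_ i j); rewrite !mxE => /(congr1 (@ratr R)).
  rewrite rmorph_sum rmorph0 => KV0; rewrite -[RHS]KV0 /W mxE; apply: eq_bigr => l _.
  by rewrite !mxE Jj mulr1n rmorphM /= ratr_int.
have SnJ j : ~~ J j -> 0 < \sum_i ratr (d i) * W i j.
  move=> /eB eBj.
  have -> : \sum_i ratr (d i) * W i j = A j + \sum_i (ratr (d i) - c 0 i) * W i j.
    by rewrite /A mW -big_split /=; apply: eq_bigr => i _; rewrite -mulrDl subrKC.
  suff : `|\sum_i (ratr (d i) - c 0 i) * W i j| <= e * B j.
    by rewrite ler_norml => /andP[? _]; lra.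
  rewrite (le_trans (ler_norm_sum _ _ _)) // mulr_sumr ler_sum // => i _.
  by rewrite normrM ler_wpM2r // ltW.
exists a => j; rewrite -(ler0z R) -pairing_lattice aW.
have -> : ((a *m (v j)^T) 0 0 = 0) = (\sum_i ratr (d i) * W i j = 0).
  apply/propext; split=> [a0|S0'].
    have := aW j; rewrite pairing_lattice a0 => /esym/eqP.
    by rewrite mulf_eq0 gt_eqF //= => /eqP.
  by apply/eqP; rewrite -(intr_eq0 R) -pairing_lattice aW S0' mulr0.
have [Jj|Jj] := boolP (J j).
  by rewrite SJ // mulr0 lexx; split=> //; split=> // _; exact/eqP.
have := SnJ _ Jj => Sj; rewrite mulr_ge0 ?ltW //; split=> //; split=> [S0'|A0].
  by move: Sj; rewrite S0' ltxx.
by move: Jj; rewrite /J A0 eqxx.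
Qed.

(** A face has an integral equation [m], and the last clause is the algebraic form of a
    localization: inverting the character [m] turns the dual monoid of [sigma] into that of
    [tau]. *)
Lemma face_integral sigma tau : rational_polyhedral sigma -> face tau sigma ->
  exists m : 'rV[int]_n, [/\ dual_monoid sigma m,
    forall u, tau u <-> sigma u /\ pairing (lattice_point m) u = 0 &
    forall a, dual_monoid tau a -> exists k, dual_monoid sigma (a + m *+ k)].
Proof.
move=> [k [v sv]] [m [m0 mt]].
have {sv} sv : sigma = generated v by [].
have [a av] : exists a, forall j, 0 <= (a *m (v j)^T) 0 0 /\
    ((a *m (v j)^T) 0 0 = 0 <-> pairing m (lattice_point (v j)) = 0).
  by apply: integral_functional => j; apply: m0; rewrite sv; exact: generated_gen.
exists a; split.
- by rewrite sv; apply: generated_dual => j; case: (av j).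
- move=> u; rewrite mt /=; split=> -[su mu]; split=> //.
    move: su mu; rewrite sv => -[t [t0 ->]]; rewrite !pairing_sumr => /eqP.
    rewrite psumr_eq0 => [/allP mu|j _]; last first.
      by rewrite pairingZr mulr_ge0 // m0 // sv; exact: generated_gen.
    rewrite big1 // => j _; have := mu j (mem_index_enum _); rewrite implyTb !pairingZr.
    by rewrite mulf_eq0 => /orP[/eqP ->|/eqP/(av j).2];
      rewrite ?mul0r // pairing_lattice => ->; rewrite mulr0.
  move: su mu; rewrite sv => -[t [t0 ->]]; rewrite !pairing_sumr => /eqP.
  rewrite psumr_eq0 => [/allP mu|j _]; last first.
    by rewrite pairingZr mulr_ge0 // pairing_lattice ler0z; case: (av j).
  rewrite big1 // => j _; have := mu j (mem_index_enum _); rewrite implyTb !pairingZr.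
  rewrite mulf_eq0 => /orP[/eqP ->|]; first by rewrite mul0r.
  by rewrite pairing_lattice intr_eq0 => /eqP/(av j).2 ->; rewrite mulr0.
(* Generators on which [a] vanishes lie in [tau], where [b] is already nonnegative. On the others
   [a] is at least 1, and this multiple outweighs any negative value of [b]. *)
- move=> b tb; exists (\sum_j absz ((b *m (v j)^T) 0 0)%R)%N.
  rewrite sv; apply: generated_dual => j; have [aj0 aj] := av j.
  rewrite mulmxDl mxE -scaler_nat -scalemxAl [X in _ + X]mxE.
  have [a0|a0] := eqVneq ((a *m (v j)^T) 0 0) 0.
    rewrite a0 mulr0 addr0 -(ler0z R) -pairing_lattice; apply: tb.
    by rewrite mt /= -aj a0 sv; split=> //; exact: generated_gen.
  have : 1 <= (a *m (v j)^T) 0 0 by rewrite -gtz0_ge1 lt_neqAle eq_sym a0.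
  rewrite (bigD1 j) //=; set x := (b *m _) 0 0; set y := (a *m _) 0 0; nia.
Qed.

End DualMonoid.

(** * Points of affine pieces *)

Section AffinePoints.
Context {R : realType} {n : nat}.
Implicit Types (sigma tau : set 'rV[R]_n) (Sigma : set (set 'rV[R]_n)).
Implicit Types (a b : 'rV[int]_n) (w x z : {ptws 'rV[int]_n -> R}).

Lemma affine1 sigma x : affine_points sigma x -> x 0 = 1.
Proof. by case. Qed.

Lemma affineD sigma x a b : affine_points sigma x ->
  dual_monoid sigma a -> dual_monoid sigma b -> x (a + b) = x a * x b.
Proof. by case=> _ xD _; exact: xD. Qed.

Lemma affineMn sigma x a k : affine_points sigma x ->
  dual_monoid sigma a -> x (a *+ k) = x a ^+ k.
Proof.
move=> sx sa; elim: k => [|k IH]; first by rewrite mulr0n (affine1 sx).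
by rewrite mulrSr exprSr (affineD sx) ?IH //; exact: dual_monoidMn.
Qed.

Lemma affine_eq sigma x z : affine_points sigma x -> affine_points sigma z ->
  (forall a, dual_monoid sigma a -> x a = z a) -> x = z.
Proof.
move=> [_ _ x0] [_ _ z0] xz; apply/funext => a.
by have [/xz//|na] := pselect (dual_monoid sigma a); rewrite x0 ?z0.
Qed.

Lemma affine_orthogonal_neq0 sigma x a :
  affine_points sigma x -> Defs.orthogonal sigma a -> x a != 0.
Proof.
move=> sx oa; have : x (a - a) = 1 by rewrite subrr (affine1 sx).
rewrite (affineD sx (orthogonal_dual oa) (orthogonal_dual (orthogonalN oa))).
by move=> xa; apply/eqP => x0; move: xa; rewrite x0 mul0r => /esym/eqP;
  rewrite oner_eq0.
Qed.

Definition dual_restrict sigma w : {ptws 'rV[int]_n -> R} :=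
  fun a => if `[< dual_monoid sigma a >] then w a else 0.

Lemma dual_restrictE sigma w a : dual_monoid sigma a -> dual_restrict sigma w a = w a.
Proof. by rewrite /dual_restrict => /asboolP ->. Qed.

(** The map from the piece of [tau] to that of [sigma] given by the inclusion of dual monoids. *)
Lemma affine_restrict sigma tau w : tau `<=` sigma ->
  affine_points tau w -> affine_points sigma (dual_restrict sigma w).
Proof.
move=> ts tw; split.
- by rewrite dual_restrictE ?(affine1 tw) //; exact: dual_monoid0.
- move=> a b sa sb; rewrite !dual_restrictE //; last exact: dual_monoidD.
  by apply: (affineD tw); exact: dual_monoidS ts _.
- by move=> a /asboolPn; rewrite /dual_restrict => /negPf ->.
Qed.

(* For a point w of the closed orbit of tau, being the point whose restriction to
   the piece is x1 is stable under gluing, hence under chains of gluings; this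
   replaces the transitivity of gluing. *)
Lemma glue_closed_orbit Sigma sigma1 sigma2 tau x1 x2 z w :
  rational_fan Sigma -> Sigma sigma1 -> Sigma sigma2 ->
  affine_points (sigma1 `&` sigma2) z ->
  (forall a, dual_monoid sigma1 a -> x1 a = z a) ->
  (forall a, dual_monoid sigma2 a -> x2 a = z a) ->
  affine_points tau w ->
  (forall a, dual_monoid tau a -> (w a != 0 <-> Defs.orthogonal tau a)) ->
  tau `<=` sigma1 -> (forall a, dual_monoid sigma1 a -> x1 a = w a) ->
  tau `<=` sigma2 /\ forall a, dual_monoid sigma2 a -> x2 a = w a.
Proof.
move=> [_ rp _ fI] S1 S2 az x1z x2z aw ow t1 x1w.
have [m0 [sm0 m0f m0k]] := face_integral (rp _ S1).1 (fI _ _ S1 S2).1.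
have zm0 : z m0 != 0.
  by apply: (affine_orthogonal_neq0 az) => u /m0f[].
have wm0 : w m0 = z m0 by rewrite -x1w // x1z.
have tm0 : dual_monoid tau m0 by exact: dual_monoidS t1 _.
(* A character not vanishing at a point of the closed orbit of [tau] is orthogonal to [tau]. As [m0]
   is an equation of the intersection in [sigma1], [tau] lies in that intersection. *)
have om0 : Defs.orthogonal tau m0 by apply/ow => //; rewrite wm0.
have t2 : tau `<=` sigma2.
  by move=> u tu; have [] : (sigma1 `&` sigma2) u by apply/m0f; split;
    [exact: t1|exact: om0].
split=> // a s2a; rewrite x2z //.
have s12 : sigma1 `&` sigma2 `<=` sigma2 by move=> u [].
have s11 : sigma1 `&` sigma2 `<=` sigma1 by move=> u [].
(* After adding multiples of [m0], the character [a] belongs to [sigma1], where [z] and [w] agree;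
   the power of the common nonzero value at [m0] then cancels. *)
have [k ka] := m0k a (dual_monoidS s12 s2a).
have m12 := dual_monoidS s11 sm0; have t2a := dual_monoidS t2 s2a.
have := x1w _ ka; rewrite (x1z _ ka).
rewrite (affineD az (dual_monoidS s12 s2a) (dual_monoidMn k m12)).
rewrite (affineMn k az m12) (affineD aw t2a (dual_monoidMn k tm0)).
rewrite (affineMn k aw tm0) wm0.
by apply: mulIf; rewrite expf_neq0.
Qed.

End AffinePoints.

(** * Rays, their adapted lattice bases and their primitive generators *)

Section Rays.
Context {R : realType} {n : nat}.
Implicit Types (sigma tau : set 'rV[R]_n) (Sigma : set (set 'rV[R]_n)).
Implicit Types (a b : 'rV[int]_n) (m : 'M[int]_n) (I : {set 'I_n}).

Definition half_line b : set 'rV[R]_n :=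
  [set t *: lattice_point b | t in [set t : R | 0 <= t]].

Lemma half_line_dual b a :
  dual_monoid (half_line b) a <-> 0 <= (a *m b^T) 0 0.
Proof.
rewrite -(ler0z R) -pairing_lattice; split=> [|ab u [t /= t0 <-]].
  by apply; exists 1; rewrite /= ?scale1r ?ler01.
by rewrite pairingZr mulr_ge0.
Qed.

Lemma half_line_orthogonal b a :
  Defs.orthogonal (half_line b) a <-> (a *m b^T) 0 0 = 0.
Proof.
split=> [|ab u [t /= t0 <-]].
  move=> /(_ (lattice_point b)); rewrite pairing_lattice => ab; apply/eqP.
  by rewrite -(intr_eq0 R) ab //; exists 1; rewrite /= ?scale1r ?ler01.
by rewrite pairingZr pairing_lattice ab mulr0.
Qed.

(** The rows of [m] are the dual basis of a lattice basis whose member number [i] is the generator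
    [b]; coordinate [i] is the one vanishing on the orbit of the ray. *)
Definition ray_basis sigma m b (i : 'I_n) : Prop :=
  [/\ m \in unitmx, b *m m^T = delta_mx 0 i & sigma = half_line b].

(** The Smith normal form writes a generator as [s] times a row of a unimodular matrix. The sign of
    [s] goes into both [m] and the new generator, so that the latter points along the ray. *)
Lemma ray_basis_exists sigma : is_ray sigma -> exists m b i, ray_basis sigma m b i.
Proof.
move=> [b b0 ->]; have /rV0Pn[[i0 lt_i0n] _] := b0.
have n0 : (0 < n)%N by exact: leq_ltn_trans lt_i0n.
have [L uL [S uS [d _ bE]]] := int_Smith_normal_form b.
pose o := Ordinal n0; pose s := L 0 0 * d`_0.
have bs : b = s *: row o S.
  rewrite bE; apply/rowP => j; rewrite !mxE (bigD1 o) //= big1 ?addr0 => [|l lo].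
    by rewrite !mxE big_ord1 !mxE.
  rewrite !mxE big_ord1 !mxE (_ : _ == _ = false) ?mulr0 ?mul0r //.
  by apply: contraNF lo => /eqP lo; apply/eqP/val_inj.
have s0 : s != 0 by apply: contra_neq b0; rewrite bs => ->; rewrite scale0r.
have sgs : sgz s * sgz s = 1 by case: (sgzP s) s0.
exists (sgz s *: (invmx S)^T), (sgz s *: row o S), o; split.
- rewrite unitmxZ; first by rewrite unitmx_tr unitmx_inv.
  by apply/unitrP; exists (sgz s); rewrite sgs.
- rewrite linearZ /= trmxK -scalemxAl -scalemxAr scalerA sgs scale1r.
  by rewrite rowE -mulmxA mulmxV // mulmx1.
have sE : s%:~R = `|s|%:~R * (sgz s)%:~R :> R.
  by rewrite -intrM {1}[s]intEsg mulrC abszE.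
have N0 : 0 < `|s|%:~R :> R by rewrite ltr0z normr_gt0.
rewrite bs; apply/seteqP; split=> _ [t /= t0 <-].
  exists (t * `|s|%:~R); first by rewrite /= mulr_ge0 // ltW.
  by rewrite !lattice_pointZ !scalerA sE mulrA.
exists (t / `|s|%:~R); first by rewrite /= divr_ge0 // ltW.
by rewrite !lattice_pointZ !scalerA sE; congr (_ *: _); field; rewrite gt_eqF.
Qed.

Lemma ray_basis_mul sigma m b i a : ray_basis sigma m b i ->
  ((a *m m) *m b^T) 0 0 = a 0 i.
Proof.
move=> [_ mb _]; rewrite -mulmxA -[m]trmxK -trmx_mul mb trmx_delta.
by rewrite mxE (bigD1 i) //= !mxE !eqxx mulr1 big1 ?addr0 // => j ji;
  rewrite mxE (negPf ji) mulr0.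
Qed.

Definition adapted_on sigma m I : Prop :=
  m \in unitmx /\ forall a, dual_monoid sigma (a *m m) <->
    forall i, i \in I -> 0 <= a 0 i.

Lemma ray_basis_adapted sigma m b i :
  ray_basis sigma m b i -> adapted_on sigma m [set i]%SET.
Proof.
move=> mbi; have [um mb sb] := mbi; split=> // a.
rewrite {1}sb half_line_dual (ray_basis_mul a mbi); split=> [ai j|].
  by rewrite inE => /eqP ->.
by apply; rewrite inE.
Qed.

Lemma vertex_adapted_unit m : m \in unitmx ->
  adapted_on [set (0 : 'rV[R]_n)] m finset.set0.
Proof.
move=> um; split=> // a.
by split=> [_ i|_]; [rewrite inE|exact: dual_monoid_set0].
Qed.

Lemma vertex_adapted : adapted_on [set (0 : 'rV[R]_n)] 1%:M finset.set0.
Proof. exact: vertex_adapted_unit (unitmx1 _ _). Qed.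

(** The scalar product with a generator is positive on the ray off the origin, so the origin is a
    face. *)
Lemma vertex_in_fan Sigma sigma : rational_fan Sigma -> Sigma sigma ->
  dim_le1 sigma -> Sigma [set 0].
Proof.
move=> [_ _ fF _] Ss [<- //|[b b0 sb]].
have pb t : pairing (lattice_point b) (t *: lattice_point b) =
    t * ((b *m b^T) 0 0)%:~R :> R by rewrite pairingZr pairing_lattice.
have bb : 0 < ((b *m b^T) 0 0)%:~R :> R.
  rewrite ltr0z mxE lt_neqAle sumr_ge0 ?andbT => [|i _];
    last by rewrite mxE -expr2 sqr_ge0.
  rewrite eq_sym psumr_eq0 => [|i _]; last by rewrite mxE -expr2 sqr_ge0.
  apply: contraNN b0 => /allP bi; apply/eqP/rowP => i.
  by have := bi i (mem_index_enum _); rewrite !mxE mulf_eq0 orbb => /eqP.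
apply: (fF sigma) => //; exists (lattice_point b); split.
  by rewrite sb => _ [t /= t0 <-]; rewrite pb mulr_ge0 // ltW.
rewrite sb; apply/seteqP; split=> [_ /= ->|u /= [[t /= t0 <-]]].
  split; last by rewrite pairing0r.
  by exists 0; rewrite /= ?scale0r.
by rewrite pb => /eqP; rewrite mulf_eq0 (gt_eqF bb) orbF => /eqP ->; rewrite scale0r.
Qed.

(** This is what confines the overlap of the charts of two distinct cones to the torus. *)
Lemma dim_le1_sub sigma tau : is_ray sigma -> dim_le1 tau -> sigma `<=` tau ->
  sigma = tau.
Proof.
move=> [b b0 sb] dt st; have sigb : sigma (lattice_point b).
  by rewrite sb; exists 1; rewrite /= ?scale1r ?ler01.
have lb0 : lattice_point b != 0 :> 'rV[R]_n.
  by apply: contra_neq b0; rewrite -lattice_point0 => /lattice_point_inj.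
case: dt => [t0|[c c0 tc]].
  by have := st _ sigb; rewrite t0 /= => lb; rewrite lb eqxx in lb0.
have := st _ sigb; rewrite tc => -[t /= t0 tcb].
have tn0 : t != 0 by apply: contra_neq lb0; rewrite -tcb => ->; rewrite scale0r.
apply/seteqP; split; first by rewrite -tc.
rewrite sb => _ [s /= s0 <-]; exists (s / t); first by rewrite /= divr_ge0.
by rewrite -tcb scalerA divfK.
Qed.

(** Pairing with row [i] of [m] shows that [c] is an integral multiple of [b]. Primitivity makes the
    factor 1 or -1, and lying on the ray excludes -1. *)
Lemma primitive_ray sigma m b i c : ray_basis sigma m b i -> primitive c ->
  sigma (lattice_point c) -> c = b.
Proof.
move=> mbi pc; have [um mb ->] := mbi; case=> t /= t0 tbc.
have cm : c *m m^T = (c *m m^T) 0 i *: delta_mx 0 i.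
  have E : map_mx intr (c *m m^T) = t *: map_mx intr (delta_mx 0 i) :> 'rV[R]_n.
    by rewrite -mb !map_mxM -[map_mx _ c]tbc -scalemxAl.
  move: (c *m m^T) E => d E.
  apply/rowP => j; have /rowP/(_ j) := E; have /rowP/(_ i) := E.
  rewrite !mxE !eqxx /= mulr1 => <-; rewrite -intrM => /intr_inj ->.
  by [].
have um' : m^T \in unitmx by rewrite unitmx_tr.
have [k ck] : exists k, c *m m^T = k *: delta_mx 0 i by exists ((c *m m^T) 0 i).
have cb : c = k *: b by rewrite -[LHS](mulmxK um') ck -mb -scalemxAl mulmxK.
have tk : t = k%:~R.
  have : lattice_point c = t *: lattice_point b :> 'rV[R]_n by rewrite tbc.
  rewrite cb lattice_pointZ => /(congr1 (fun u => (u *m map_mx intr m^T) 0 i)).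
  rewrite -!scalemxAl -map_mxM /= mb !mxE.
  by rewrite !eqxx !mulr1 => ->.
have := pc _ _ cb; rewrite ger0_norm => [k1|]; last by rewrite -(ler0z R) -tk.
by rewrite cb k1 scale1r.
Qed.

Lemma ray_basis_primitive sigma m b i : ray_basis sigma m b i -> primitive b.
Proof.
move=> [_ mb _] k c bk; have /rowP/(_ i) := mb.
rewrite bk -scalemxAl !mxE !eqxx /= => kc.
move/(congr1 absz): kc; rewrite abszM => /eqP; rewrite muln_eq1 => /andP[/eqP k1 _].
by rewrite -abszE k1.
Qed.
End Rays.

(** * Coordinates on affine pieces from adapted bases *)

Section Parametrization.
Context {R : realType} {n : nat}.
Implicit Types (sigma tau : set 'rV[R]_n) (Sigma : set (set 'rV[R]_n)).
Implicit Types (a b : 'rV[int]_n) (m : 'M[int]_n) (I : {set 'I_n}).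
Implicit Types (y : 'rV[R]_n) (w x z : {ptws 'rV[int]_n -> R}).

Definition off_zero I y : Prop := forall i, i \notin I -> y 0 i != 0.

Definition values m x : 'rV[R]_n := \row_i x (row i m).

(** The inverse of [values m]: the characters of [sigma] are monomials in the coordinates given by
    the rows of [m]. *)
Definition point_of sigma m y : {ptws 'rV[int]_n -> R} :=
  fun a => if `[< dual_monoid sigma a >] then monomial (a *m invmx m) y else 0.

Lemma monomial0 y : monomial 0 y = 1.
Proof. by rewrite /monomial big1 // => i _; rewrite mxE. Qed.

(** At a vanishing coordinate, exponents of opposite signs would break the identity; hence the
    conditions on [I]. *)
Lemma monomialD I a b y : off_zero I y ->
  (forall i, i \in I -> 0 <= a 0 i) -> (forall i, i \in I -> 0 <= b 0 i) ->
  monomial (a + b) y = monomial a y * monomial b y.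
Proof.
move=> yI aI bI; rewrite /monomial -big_split; apply: eq_bigr => i _ /=.
rewrite mxE; have [iI|iI] := boolP (i \in I); last by rewrite expfzDr ?yI.
by case: (a 0 i) (aI _ iI) => // k _; case: (b 0 i) (bI _ iI) => // l _; rewrite -exprD.
Qed.

Lemma adapted_dual sigma m I a : adapted_on sigma m I ->
  dual_monoid sigma a <-> forall i, i \in I -> 0 <= (a *m invmx m) 0 i.
Proof. by move=> [um mI]; rewrite -mI mulmxKV. Qed.

Lemma adapted_row sigma m I i : adapted_on sigma m I -> dual_monoid sigma (row i m).
Proof.
move=> [um mI]; rewrite rowE; apply/mI => j _; rewrite mxE eqxx /=.
exact: ler0n.
Qed.

Lemma adapted_rowN sigma m I i : adapted_on sigma m I -> i \notin I ->
  dual_monoid sigma (- row i m).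
Proof.
move=> [um mI] iI; rewrite rowE -mulNmx; apply/mI => j jI; rewrite !mxE.
by rewrite (_ : j == i = false) ?andbF //; apply: contraNF iI => /eqP <-.
Qed.

Lemma affine_point_of sigma m I y : adapted_on sigma m I -> off_zero I y ->
  affine_points sigma (point_of sigma m y).
Proof.
move=> mI yI; split.
- by rewrite /point_of (asboolT (@dual_monoid0 _ _ _)) mul0mx monomial0.
- move=> a b sa sb; rewrite /point_of !asboolT //; last exact: dual_monoidD.
  by rewrite mulmxDl (monomialD yI) //; exact/(adapted_dual _ mI).
- by move=> a sa; rewrite /point_of asboolF.
Qed.

Lemma values_point_of sigma m I y : adapted_on sigma m I ->
  values m (point_of sigma m y) = y.
Proof.
move=> mI; apply/rowP => i; rewrite mxE /point_of asboolT; last exact: adapted_row mI.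
rewrite rowE mulmxK; last by case: mI.
rewrite /monomial (bigD1 i) //= mxE !eqxx expr1z big1 ?mulr1 // => j ji.
by rewrite mxE eqxx (negPf ji).
Qed.

Lemma values_off_zero sigma m I x : adapted_on sigma m I -> affine_points sigma x ->
  off_zero I (values m x).
Proof.
move=> mI sx i iI; rewrite mxE.
have : x (row i m - row i m) = 1 by rewrite subrr (affine1 sx).
rewrite (affineD sx (adapted_row i mI) (adapted_rowN mI iI)) => xi.
by apply/eqP => x0; move: xi; rewrite x0 mul0r => /esym/eqP; rewrite oner_eq0.
Qed.

Lemma affine_monomial sigma m I x a : adapted_on sigma m I -> affine_points sigma x ->
  dual_monoid sigma a -> x a = monomial (a *m invmx m) (values m x).
Proof.
move=> mI sx sa; have [um _] := mI; have /(adapted_dual _ mI) := sa.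
have aE := mulmxKV um a; set c := a *m invmx m in aE * => cI.
have -> : x a = x (\sum_i c 0 i *: row i m) by rewrite -mulmx_sum_row aE.
rewrite /monomial.
(* Membership of the partial sums is carried along because [x] is multiplicative only on the dual
   monoid. *)
suff : forall r : seq 'I_n, dual_monoid sigma (\sum_(i <- r) c 0 i *: row i m) /\
    x (\sum_(i <- r) c 0 i *: row i m) = \prod_(i <- r) values m x 0 i ^ c 0 i.
  by move=> /(_ (index_enum _))[].
elim=> [|i r [IH1 IH2]].
  by rewrite !big_nil; split; [exact: dual_monoid0|exact: affine1 sx].
rewrite !big_cons.
suff [si xi] : dual_monoid sigma (c 0 i *: row i m) /\
    x (c 0 i *: row i m) = values m x 0 i ^ c 0 i.
  by split; [exact: dual_monoidD|rewrite (affineD sx) // xi IH2].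
have ri := adapted_row i mI.
case: (c 0 i) (cI i) => k ck.
  rewrite -{1 2}natz !scaler_nat; split; first exact: dual_monoidMn.
  by rewrite (affineMn k sx ri) mxE.
have iI : i \notin I by apply/negP => /ck.
have sN := adapted_rowN mI iI.
rewrite NegzE scaleNr -scalerN -{1 2}natz !scaler_nat; split;
  first exact: dual_monoidMn.
rewrite (affineMn _ sx sN) -exprnN mxE -exprVn; congr (_ ^+ _).
have : x (row i m - row i m) = 1 by rewrite subrr (affine1 sx).
by rewrite (affineD sx ri sN) => /mulr1_eq ->.
Qed.
End Parametrization.

(** * The real toric variety and its charts *)

Lemma cvg_pointwise {U : choiceType} {V : topologicalType} (F : set_system (U -> V))
    (f : U -> V) : Filter F -> (forall t, (fun g => g t) @ F --> f t) ->
  F --> (f : {ptws U -> V}).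
Proof.
move=> FF Ff; apply/cvg_sup => i; apply/cvg_image.
  by rewrite eqEsubset; split=> v // _; exists (fun=> v).
move=> W /= /Ff; rewrite nbhs_simpl => FW; exists ((fun g => g i) @^-1` W) => //.
by rewrite eqEsubset; split=> [j [? + <-//]|j Wj]; exists (fun=> j).
Qed.

Section Gluing.
Context {R : realType} {n : nat} (Sigma : set (set 'rV[R]_n)).
Hypothesis fanSigma : rational_fan Sigma.
Implicit Types (sigma tau : Sigma) (a b : 'rV[int]_n).
Implicit Types (w x z : {ptws 'rV[int]_n -> R}).

Notation piece sigma := (set_type (affine_points (val sigma))).
Notation incl := (@affine_inclusion R n Sigma _).

Lemma fan_mem sigma : Sigma (val sigma).
Proof. exact/set_mem/valP. Qed.

Lemma piece_affine sigma (x : piece sigma) : affine_points (val sigma) (val x).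
Proof. exact/set_mem/valP. Qed.

Definition piece_of sigma x (xs : affine_points (val sigma) x) : piece sigma :=
  exist _ x (mem_set xs).

(** The invariant of [glue_closed_orbit], transported along the chain of gluings behind an equality
    in the quotient. *)
Lemma incl_closed_orbit (tau : set 'rV[R]_n) w sigma (x : piece sigma) sigma' (x' :
  piece sigma') :
  incl x = incl x' -> affine_points tau w ->
  (forall a, dual_monoid tau a -> (w a != 0 <-> Defs.orthogonal tau a)) ->
  (tau `<=` val sigma /\ forall a, dual_monoid (val sigma) a -> val x a = w a) <->
  (tau `<=` val sigma' /\ forall a, dual_monoid (val sigma') a -> val x' a = w a).
Proof.
move=> xx' tw ow.
pose P (p : {sigma : Sigma & piece sigma}) := tau `<=` val (projT1 p) /\
  forall a, dual_monoid (val (projT1 p)) a -> val (projT2 p) a = w a.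
suff : P (existT _ sigma x) <-> P (existT _ sigma' x') by [].
have : clos_refl_sym_trans _ (@glued R n Sigma) (existT _ sigma x) (existT _ sigma' x').
  by apply/asboolP; move: xx' => /eqmodP.
elim=> [{xx'} p q [z [pz qz]]|p|p q _ H|p q r _ H1 _ H2]; last 3 first.
- by [].
- by split=> /H.
- by split=> [/H1/H2|/H2/H1].
have az : affine_points (val (projT1 p) `&` val (projT1 q)) (val z).
  by have /set_mem := valP z.
move: (val z) az pz qz => {}z az pz qz.
split=> -[t1 xw].
  exact: (glue_closed_orbit fanSigma (fan_mem _) (fan_mem _) az pz qz tw ow t1 xw).
rewrite setIC in az.
exact: (glue_closed_orbit fanSigma (fan_mem _) (fan_mem _) az qz pz tw ow t1 xw).
Qed.

Lemma incl_restrict sigma tau (x : piece sigma) (w : piece tau) :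
  val tau `<=` val sigma -> (forall a, dual_monoid (val sigma) a -> val x a = val w
    a) ->
  incl x = incl w.
Proof.
move=> ts xw; apply/eqmodP/asboolP; apply: rst_step.
have az : affine_points (val sigma `&` val tau) (val w).
  by rewrite setIidr //; exact: piece_affine.
by exists (exist _ (val w) (mem_set az)).
Qed.

Lemma incl_continuous sigma : continuous (fun x : piece sigma => incl x).
Proof.
apply/continuousP => A oA.
exact: (proj1 (sigT_openP _) oA sigma).
Qed.

Lemma toric_openP (U : set (real_toric_variety Sigma)) :
  (forall sigma, open [set x : piece sigma | U (incl x)]) -> open U.
Proof. by move=> oU; apply/sigT_openP. Qed.

(** The quotient topology is described by open sets, so continuity at [p] is drawn from continuity
    on all pieces over a whole open neighborhood of [p]. *)
Lemma toric_continuous_at {Z : topologicalType} (f : real_toric_variety Sigma -> Z)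
    (U : set (real_toric_variety Sigma)) p : open U -> U p ->
  (forall sigma (x : piece sigma), U (incl x) ->
     {for x, continuous (fun x' : piece sigma => f (incl x'))}) ->
  {for p, continuous f}.
Proof.
move=> oU Up fc N /= Np; rewrite nbhs_filterE.
pose O := [set q | U q /\ (N^° (f q))].
have oO : open O.
  apply: toric_openP => sigma; rewrite openE => x [/= Ux Nx].
  have h1 : \forall x' \near x, U (incl x').
    by apply: incl_continuous; exact: open_nbhs_nbhs.
  have h2 : \forall x' \near x, N^° (f (incl x')).
    by apply: (fc _ _ Ux); apply: nbhs_interior.
  by rewrite /interior /=; near=> x'; split; near: x'.
have : nbhs p O.
  by apply: open_nbhs_nbhs; split=> //; split=> //; apply: nbhs_singleton;
    exact: nbhs_interior.
by apply: filterS => q [_ /nbhs_singleton].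
Unshelve. all: by end_near.
Qed.

Lemma eval_continuous_at sigma a : continuous (fun x : piece sigma => val x a : R).
Proof.
move=> x; apply: (@continuous_comp _ _ _ (fun x : piece sigma => val x)
  (fun w : {ptws 'rV[int]_n -> R} => w a)); first exact: initial_continuous.
exact: proj_continuous.
Qed.

Lemma cvg_piece {T : Type} (F : set_system T) (FF : Filter F) sigma
    (f : T -> piece sigma) (x : piece sigma) :
  (forall a, val (f t) a @[t --> F] --> (val x a : R)) -> f t @[t --> F] --> x.
Proof.
move=> fx A [_ [[B oB <-] /= Bx BA]].
have : (fun t => val (f t)) @ F --> (val x : {ptws 'rV[int]_n -> R}).
  by apply: cvg_pointwise => a; exact: fx.
have BB := open_nbhs_nbhs (conj oB Bx : open_nbhs (set_val x) B).
move=> /(_ B BB) FB; rewrite /= nbhs_filterE in FB *.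
by apply: (@filterS _ F _ _ _ _ FB) => t Bt; exact: BA.
Qed.

End Gluing.

(** * Localization at a face and the two orbits in the piece of a ray *)

Section Extension.
Context {R : realType} {n : nat}.
Implicit Types (sigma tau : set 'rV[R]_n) (a b : 'rV[int]_n).
Implicit Types (w x z : {ptws 'rV[int]_n -> R}).

(** Where the character [m0] does not vanish, a point extends to the localized monoid by fractions,
    whose values do not depend on the exponent chosen. *)
Lemma affine_extension sigma tau m0 x : affine_points sigma x ->
  dual_monoid sigma m0 -> x m0 != 0 -> tau `<=` sigma ->
  (forall a, dual_monoid tau a -> exists k, dual_monoid sigma (a + m0 *+ k)) ->
  exists w, affine_points tau w /\ forall a k, dual_monoid tau a ->
    dual_monoid sigma (a + m0 *+ k) -> w a = x (a + m0 *+ k) / x m0 ^+ k.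
Proof.
move=> sx sm0 xm0 ts ext.
have indep a k l : dual_monoid sigma (a + m0 *+ k) -> dual_monoid sigma (a + m0 *+ l) ->
    x (a + m0 *+ k) / x m0 ^+ k = x (a + m0 *+ l) / x m0 ^+ l.
  move=> sk sl; apply/eqP; rewrite eqr_div ?expf_neq0 //; apply/eqP.
  rewrite -!(affineMn _ sx sm0) -(affineD sx sk (dual_monoidMn l sm0)).
  rewrite -(affineD sx sl (dual_monoidMn k sm0)).
  by rewrite -!addrA -!mulrnDr addnC.
have ext' a : exists k, dual_monoid tau a -> dual_monoid sigma (a + m0 *+ k).
  by have [/ext[k ak]|na] := pselect (dual_monoid tau a); [exists k|exists 0%N].
have [K aK] := choice ext'.
pose w : {ptws 'rV[int]_n -> R} := dual_restrict tau (fun a => x (a + m0 *+ K a) / x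
  m0 ^+ K a).
have wE a k : dual_monoid tau a -> dual_monoid sigma (a + m0 *+ k) ->
    w a = x (a + m0 *+ k) / x m0 ^+ k.
  by move=> ta sk; rewrite /w dual_restrictE //; apply: indep => //; exact: aK.
exists w; split=> //; split.
- rewrite (wE 0 0%N); rewrite ?mulr0n ?addr0 ?expr0 ?divr1 ?(affine1 sx) //.
    exact: dual_monoid0.
  exact: dual_monoid0.
- move=> a b ta tb; have ab : a + b + m0 *+ (K a + K b) = (a + m0 *+ K a) + (b + m0
  *+ K b).
    by rewrite mulrnDr addrACA.
  have sab := dual_monoidD (aK _ ta) (aK _ tb).
  rewrite (wE _ (K a + K b)%N); [|exact: dual_monoidD|by rewrite ab].
  rewrite ab (affineD sx (aK _ ta) (aK _ tb)) (wE a (K a)) ?(wE b (K b)) //;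
    do ?exact: aK.
  by rewrite exprD invfM mulrACA.
- by move=> a na; rewrite /w /dual_restrict asboolF.
Qed.

Lemma vertex_orthogonal a : Defs.orthogonal [set (0 : 'rV[R]_n)] a.
Proof. by move=> u ->; rewrite pairing0r. Qed.

Lemma vertex_neq0 w a : affine_points [set (0 : 'rV[R]_n)] w -> w a != 0.
Proof. by move=> aw; apply: (affine_orthogonal_neq0 aw); exact: vertex_orthogonal. Qed.

(** The coordinate along the ray decides: if it is nonzero the point comes from the torus, otherwise
    it lies in the closed orbit. *)
Lemma ray_points sigma x : is_ray sigma -> affine_points sigma x ->
  (exists w, affine_points [set (0 : 'rV[R]_n)] w /\
     forall a, dual_monoid sigma a -> x a = w a) \/
  forall a, dual_monoid sigma a -> (x a != 0 <-> Defs.orthogonal sigma a).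
Proof.
move=> /ray_basis_exists[m [b [i mbi]]] sx; have [um _ sb] := mbi.
have mI := ray_basis_adapted mbi; have yI := values_off_zero mI sx.
have xE a := @affine_monomial _ _ _ _ _ _ a mI sx.
have [yi|yi] := eqVneq (values m x 0 i) 0; [right|left].
  move=> a sa; rewrite xE // sb half_line_orthogonal.
  rewrite -[in X in _ <-> X](mulmxKV um a) (ray_basis_mul _ mbi).
  have ci : 0 <= (a *m invmx m) 0 i by apply: (adapted_dual _ mI).1 => //; rewrite inE.
  rewrite /monomial (bigD1 i) //= yi; split=> [|ci0]; first last.
    rewrite ci0 expr0z mul1r; apply/prodf_neq0 => j ji.
    by apply: expfz_neq0; apply: yI; rewrite inE.
  apply: contra_neqP => ci0; rewrite exp0rz; case: eqP ci0 => // _ _.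
  by rewrite mul0r.
exists (point_of [set 0] m (values m x)); split.
  apply: (@affine_point_of _ _ _ _ finset.set0); first exact: vertex_adapted_unit.
  move=> j _; have [->//|ji] := eqVneq j i.
  by apply: yI; rewrite inE.
by move=> a sa; rewrite xE // /point_of asboolT //; exact: dual_monoid_set0.
Qed.

End Extension.

Section Charts.
Context {R : realType} {n : nat} (Sigma : set (set 'rV[R]_n)).
Hypothesis fanSigma : rational_fan Sigma.
Implicit Types (sigma tau : Sigma) (a b : 'rV[int]_n) (m : 'M[int]_n) (I : {set 'I_n}).
Implicit Types (w x z : {ptws 'rV[int]_n -> R}).

Notation piece sigma := (set_type (affine_points (val sigma))).
Notation incl := (@affine_inclusion R n Sigma _).
Notation Y := (real_toric_variety Sigma).

(** Supplies the pair [tau], [w] to which the gluing invariant [incl_closed_orbit] applies. *)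
Lemma closed_orbit_point sigma (x : piece sigma) : dim_le1 (val sigma) ->
  exists tau w, [/\ val tau = [set 0] \/ is_ray (val sigma) /\ tau = sigma,
    val tau `<=` val sigma, affine_points (val tau) w,
    forall a, dual_monoid (val tau) a -> (w a != 0 <-> Defs.orthogonal (val tau) a) &
    forall a, dual_monoid (val sigma) a -> val x a = w a].
Proof.
move=> ds; have S0 := vertex_in_fan fanSigma (fan_mem sigma) ds.
have vertex (t0 : set 'rV[R]_n) w : t0 = [set 0] -> affine_points t0 w ->
    forall a, dual_monoid t0 a -> (w a != 0 <-> Defs.orthogonal t0 a).
  by move=> -> aw a _; split=> _; [exact: vertex_orthogonal|exact: vertex_neq0].
have xs := piece_affine x; have [s0|rs] := ds.
  exists sigma, (val x); split=> //; first by left.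
  exact: vertex.
have [[w [aw xw]]|ox] := ray_points rs xs; last first.
  by exists sigma, (val x); split=> //; right.
exists (exist _ [set 0] (mem_set S0)), w; split=> //; first by left.
  move=> u /= ->; have [b b0 ->] := rs.
  by exists 0; rewrite /= ?scale0r.
exact: vertex.
Qed.

Lemma incl_inj sigma (x x' : piece sigma) : dim_le1 (val sigma) ->
  incl x = incl x' -> x = x'.
Proof.
move=> ds xx'; have [tau [w [_ ts tw ow xw]]] := closed_orbit_point x ds.
have [_ x'w] := (incl_closed_orbit fanSigma xx' tw ow).1 (conj ts xw).
apply/val_inj/(affine_eq (piece_affine x) (piece_affine x')) => a sa.
by rewrite xw // x'w.
Qed.

(** If the common point lay in the closed orbit of the ray [sigma], this ray would be contained in
    [sigma'], hence equal to it. *)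
Lemma distinct_charts_meet sigma sigma' (x : piece sigma) (x' : piece sigma') :
  dim_le1 (val sigma) -> dim_le1 (val sigma') -> sigma <> sigma' -> incl x = incl x' ->
  exists2 w, affine_points [set (0 : 'rV[R]_n)] w &
    (forall a, dual_monoid (val sigma) a -> val x a = w a) /\
    (forall a, dual_monoid (val sigma') a -> val x' a = w a).
Proof.
move=> ds ds' ss' xx'; have [tau [w [t0 ts tw ow xw]]] := closed_orbit_point x ds.
have [ts' x'w] := (incl_closed_orbit fanSigma xx' tw ow).1 (conj ts xw).
case: t0 => [t0|[rs ts0]]; first by exists w => //; rewrite -t0.
by case: ss'; apply/val_inj; apply: dim_le1_sub => //; rewrite -ts0.
Qed.

(** Here [sigma'] is any cone of the fan. Near [x'] its piece is covered by the piece of [sigma] on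
    the set where [m0] does not vanish, with explicit fractions as coordinates; this gives openness
    and continuity of the charts in the quotient. *)
Lemma chart_neighborhood sigma sigma' (x : piece sigma) (x' : piece sigma') :
  dim_le1 (val sigma) -> incl x' = incl x ->
  exists m0 : 'rV[int]_n, [/\ dual_monoid (val sigma') m0, val x' m0 != 0,
    forall a, dual_monoid (val sigma) a -> exists k, dual_monoid (val sigma') (a + m0
      *+ k) &
    forall z : piece sigma', val z m0 != 0 -> exists2 w : piece sigma, incl z = incl w &
      forall a k, dual_monoid (val sigma) a -> dual_monoid (val sigma') (a + m0 *+ k) ->
        val w a = val z (a + m0 *+ k) / val z m0 ^+ k].
Proof.
move=> ds xx'; have [tau [w0 [_ ts tw ow xw]]] := closed_orbit_point x ds.
have [ts' x'w] := (incl_closed_orbit fanSigma xx' tw ow).2 (conj ts xw).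
have [_ rp _ fI] := fanSigma.
have := (fI _ _ (fan_mem sigma') (fan_mem tau)).1; rewrite setIidr // => tf.
have [m0 [sm0 m0f m0k]] := face_integral (rp _ (fan_mem sigma')).1 tf.
exists m0; split=> //.
- rewrite x'w //; apply: (affine_orthogonal_neq0 tw) => u /m0f[_].
  exact.
- by move=> a sa; apply: m0k; exact: dual_monoidS ts _.
move=> z zm0; have [w [aw wE]] := affine_extension (piece_affine z) sm0 zm0 ts' m0k.
have sw := affine_restrict ts aw.
exists (piece_of sw).
  transitivity (affine_inclusion (piece_of aw)).
    apply: incl_restrict => // a sa;
      rewrite /= (wE a 0%N) ?mulr0n ?addr0 ?expr0 ?divr1 //.
    exact: dual_monoidS ts' _.
  by apply/esym; apply: incl_restrict => // a sa /=; rewrite dual_restrictE.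
move=> a k sa sk; rewrite /= dual_restrictE // -wE //.
exact: dual_monoidS ts _.
Qed.

Lemma near_eval_neq0 sigma (x : piece sigma) a :
  val x a != 0 -> \forall z \near x, val z a != 0.
Proof.
move=> xa; apply: (@eval_continuous_at _ _ _ sigma a x [set t | t != 0]).
by apply: open_nbhs_nbhs; split=> //; exact: open_neq.
Qed.

Lemma open_range_incl sigma : dim_le1 (val sigma) ->
  open (range (fun x : piece sigma => incl x)).
Proof.
move=> ds; apply: toric_openP => sigma'; rewrite openE => x' [x _ xx'].
have [m0 [_ xm0 _ m0z]] := chart_neighborhood ds (esym xx').
have : \forall z \near x', val z m0 != 0.
  exact: near_eval_neq0.
by apply: filterS => z /m0z[w zw _]; exists w.
Qed.

Definition chart_values sigma m (p : Y) : 'rV[R]_n :=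
  if pselect (exists x : piece sigma, incl x = p) is left e
  then values m (val (projT1 (cid e))) else 0.

Lemma chart_valuesE sigma m (x : piece sigma) : dim_le1 (val sigma) ->
  chart_values sigma m (incl x) = values m (val x).
Proof.
move=> ds; rewrite /chart_values; case: pselect => [e|[]]; last by exists x.
by case: cid => z /= /(incl_inj ds) ->.
Qed.

Lemma chart_values_continuous sigma m I (p : Y) : dim_le1 (val sigma) ->
  adapted_on (val sigma) m I -> range (fun x : piece sigma => incl x) p ->
  {for p, continuous (chart_values sigma m)}.
Proof.
move=> ds mI Up.
apply: (toric_continuous_at (open_range_incl ds) Up) => sigma' x' [x _ xx'].
have [m0 [_ xm0 m0k m0z]] := chart_neighborhood ds (esym xx').
have /choice[k kP] : forall i, exists k, dual_monoid (val sigma') (row i m + m0 *+ k).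
  by move=> i; apply: m0k; exact: adapted_row mI.
pose g (z : piece sigma') : 'rV[R]_n := \row_i (val z (row i m + m0 *+ k i) / val z
  m0 ^+ k i).
have zm0 : \forall z \near x', val z m0 != 0.
  exact: near_eval_neq0.
apply: (@near_eq_continuous_at _ _ g).
  apply: filterS zm0 => z /m0z[w -> wE]; rewrite chart_valuesE //.
  by apply/rowP => i; rewrite !mxE (wE _ (k i)) //; exact: adapted_row mI.
apply: (@cvg_mx_entries _ _ _ _ (nbhs x') g (g x')) => i j; rewrite mxE.
under eq_cvg do rewrite mxE.
apply: cvgM; first exact: eval_continuous_at.
apply: cvgV; first by rewrite expf_neq0.
apply: (@cvg_comp _ _ _ (fun z : piece sigma' => val z m0) (fun t : R => t ^+ k j)).
  exact: eval_continuous_at.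
exact: exprn_continuous.
Qed.

End Charts.

Section ToricCharts.
Context {R : realType} {n : nat} (Sigma : set (set 'rV[R]_n)).
Hypothesis fanSigma : rational_fan Sigma.
Implicit Types (sigma tau : Sigma) (a b : 'rV[int]_n) (m : 'M[int]_n) (I : {set 'I_n}).
Implicit Types (w x : {ptws 'rV[int]_n -> R}) (y d : 'rV[R]_n).

Notation piece sigma := (set_type (affine_points (val sigma))).
Notation incl := (@affine_inclusion R n Sigma _).
Notation Y := (real_toric_variety Sigma).
Notation M := (@toric_open_part R n Sigma).

Lemma open_off_zero I : open [set y : 'rV[R]_n | off_zero I y].
Proof.
rewrite openE => y yI.
rewrite /interior /=.
have yF : Filter (nbhs (y : 'rV[R]_n)) by exact: nbhs_filter.
apply: (@filter_forall 'rV[R]_n _ (fun i z => i \notin I -> z 0 i != 0) _ yF).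
move=> i; have [iI|iI] := boolP (i \in I); first by near=> z.
have : \forall z \near nbhs (y : 'rV[R]_n), (z : 'rV[R]_n) 0 i != 0.
  apply: (@coord_continuous _ _ _ 0 i y [set t : R | t != 0]).
  by apply: open_nbhs_nbhs; split; [exact: open_neq|exact: yI].
by apply: filterS.
Unshelve. all: by end_near.
Qed.

(** The inverse parametrization, made total by the default point [o]. *)
Definition chart_point sigma m (o : piece sigma) y : piece sigma :=
  insubd o (point_of (val sigma) m y).

Lemma val_chart_point sigma m I (o : piece sigma) y :
  adapted_on (val sigma) m I -> off_zero I y ->
  val (chart_point m o y) = point_of (val sigma) m y.
Proof.
move=> mI yI; apply: insubdK; apply/mem_set; exact: affine_point_of mI yI.
Qed.

Lemma chart_pointK sigma m I (o x : piece sigma) :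
  adapted_on (val sigma) m I -> chart_point m o (values m (val x)) = x.
Proof.
move=> mI; have xs := piece_affine x; have yI := values_off_zero mI xs.
apply/val_inj; rewrite (val_chart_point o mI yI).
apply: (affine_eq (affine_point_of mI yI) xs) => a sa.
by rewrite (affine_monomial mI xs sa) /point_of asboolT.
Qed.

Lemma values_chart_point sigma m I (o : piece sigma) y :
  adapted_on (val sigma) m I -> off_zero I y -> values m (val (chart_point m o y)) = y.
Proof. by move=> mI yI; rewrite (val_chart_point o mI yI) (values_point_of _ mI). Qed.

Lemma chart_point_continuous sigma m I (o : piece sigma) y :
  adapted_on (val sigma) m I -> off_zero I y ->
  {for y, continuous (chart_point m o)}.
Proof.
move=> mI yI; apply: (@cvg_piece _ _ _ _ (nbhs y)) => a.
have ny : \forall z \near y, off_zero I z.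
  by apply: open_nbhs_nbhs; split=> //; exact: open_off_zero.
apply: (@near_eq_continuous_at _ _ (fun z => point_of (val sigma) m z a : R)
  (fun z => val (chart_point m o z) a : R) y).
  by apply: filterS ny => z zI; rewrite (val_chart_point o mI zI).
rewrite /point_of; case: asboolP => sa; last exact: cst_continuous.
apply: differentiable_continuous.
apply: (@regular_differentiable _ _ [set z | off_zero I z]) => //.
apply: regular_monomial => j; have [jI|jI] := boolP (j \in I).
  by left; apply: (adapted_dual _ mI).1.
by right=> z; apply.
Qed.

(** The continuous parametrization [chart_point] inverts the coordinates, so the image of [V] is
    locally its preimage. *)
Lemma chart_values_open sigma m I (V : set Y) : dim_le1 (val sigma) ->
  adapted_on (val sigma) m I -> open V -> V `<=` range (fun x : piece sigma => incl
    x) ->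
  open (chart_values sigma m @` V).
Proof.
move=> ds mI oV VU; rewrite openE => _ [p Vp <-]; have [x _ xp] := VU _ Vp.
rewrite -xp (chart_valuesE fanSigma) //; set y := values m (val x).
have yI : off_zero I y by exact: values_off_zero mI (piece_affine x).
have ny : \forall z \near y, off_zero I z.
  by apply: open_nbhs_nbhs; split=> //; exact: open_off_zero.
have nV : \forall z \near y, V (incl (chart_point m x z)).
  apply: (@chart_point_continuous _ _ _ x _ mI yI [set x' | V (incl x')]).
  rewrite (chart_pointK x x mI); apply: incl_continuous.
  by apply: open_nbhs_nbhs; rewrite xp.
rewrite /interior; near=> z.
exists (incl (chart_point m x z)); first by near: z.
rewrite (chart_valuesE fanSigma) // (values_chart_point _ mI) //.
by near: z.
Unshelve. all: by end_near.
Qed.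

Lemma range_open_part sigma : dim_le1 (val sigma) ->
  range (fun x : piece sigma => incl x) `<=` M.
Proof.
move=> ds _ [x _ <-]; have [tau [w [tE ts tw ow xw]]] := closed_orbit_point fanSigma
  x ds.
exists tau; first by rewrite /=; case: tE => [->|[_ ->]] //; left.
exists (piece_of tw) => //=.
by apply/esym; apply: incl_restrict.
Qed.

Lemma open_part_range p : M p ->
  exists sigma (x : piece sigma), dim_le1 (val sigma) /\ incl x = p.
Proof. by move=> [sigma ds [x _ <-]]; exists sigma, x. Qed.

Lemma segment_off_zero I y y' (t : R) :
  (forall i, i \notin I -> 0 < y 0 i * y' 0 i) -> 0 <= t <= 1 ->
  off_zero I (y + t *: (y' - y)).
Proof.
move=> yy' /andP[t0 t1] i /yy' yyi; rewrite !mxE.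
move: (y 0 i) (y' 0 i) yyi => u v uv; apply/eqP => uv0.
(* Multiplying by [u] gives a convex combination of the positive numbers [u * u] and [u * v]. *)
have uv1 : u * u + t * (u * v - u * u) = 0 by rewrite -mulrBr mulrCA -mulrDr uv0 mulr0.
have u0 : 0 < u * u.
  by rewrite -expr2 exprn_even_gt0 //=; apply: contraTneq uv => ->; rewrite mul0r ltxx.
have h1 : 0 <= (1 - t) * (u * u) by rewrite mulr_ge0 ?subr_ge0 // ltW.
have [t00|tn0] := eqVneq t 0; first by rewrite t00 in uv1; lra.
have h2 : 0 < t * (u * v) by rewrite mulr_gt0 // lt_neqAle eq_sym tn0.
lra.
Qed.

(** Coordinates in [I] are unconstrained, so the segment joining the two points may cross the orbit
    of a ray. *)
Lemma orthant_connected sigma m I (x x' : piece sigma) :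
  adapted_on (val sigma) m I ->
  (forall i, i \notin I -> 0 < values m (val x) 0 i * values m (val x') 0 i) ->
  exists C : set Y, [/\ connected C, C (incl x), C (incl x') &
    C `<=` range (fun z : piece sigma => incl z)].
Proof.
move=> mI yy'; set y := values m (val x) in yy'; set y' := values m (val x') in yy'.
pose seg (t : R) := y + t *: (y' - y).
have segI t : 0 <= t <= 1 -> off_zero I (seg t) by exact: segment_off_zero.
exists ((fun t => incl (chart_point m x (seg t))) @` `[0, 1]); split.
- apply: connected_continuous_connected; first exact: segment_connected.
  apply: continuous_in_subspaceT => t; rewrite inE /= in_itv /= => t01.
  apply: (@continuous_comp _ _ _ (fun t => chart_point m x (seg t)) (fun z : piece
    sigma => incl z)).
    apply: (@continuous_comp _ _ _ seg (chart_point m x));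
      last exact: chart_point_continuous mI (segI _ t01).
    apply: cvgD; first exact: cvg_cst.
    by apply: cvgZ; [exact: cvg_id|exact: cvg_cst].
  exact: incl_continuous.
- exists 0; first by rewrite /= in_itv /= lexx ler01.
  by rewrite /seg scale0r addr0 (chart_pointK _ _ mI).
- exists 1; first by rewrite /= in_itv /= lexx ler01.
  by rewrite /seg scale1r addrC subrK (chart_pointK _ _ mI).
- by move=> _ [t _ <-]; eexists.
Qed.

(* d rescales the coordinates of an affine piece; it is constant equal to 1 for
   the charts of the toric atlas. *)
Definition monomial_chart sigma m I d (c : @chart R n Y) : Prop :=
  [/\ dim_le1 (val sigma) /\ adapted_on (val sigma) m I, forall i, d 0 i != 0,
    open (dom c), dom c `<=` range (fun x : piece sigma => incl x) &
    forall x : piece sigma, dom c (incl x) ->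
      Defs.coord c (incl x) = \row_i (d 0 i * values m (val x) 0 i)].

Lemma toric_monomial_chart c : toric_chart c ->
  exists sigma m I, monomial_chart sigma m I (const_mx 1) c /\
    dom c = range (fun x : piece sigma => incl x).
Proof.
move=> [sigma [m [ds [um [I mI]] dc cc]]]; exists sigma, m, I; split=> //; split=> //.
- by move=> i; rewrite mxE oner_neq0.
- by rewrite dc; exact: open_range_incl.
- by rewrite dc.
- by move=> x _; rewrite cc; apply/rowP => i; rewrite !mxE mul1r.
Qed.

Definition dilation d y : 'rV[R]_n := \row_i (d 0 i * y 0 i).

Lemma dilation_continuous d : continuous (dilation d).
Proof.
move=> y; apply: (@cvg_mx_entries _ _ _ _ (nbhs y) (dilation d)) => i j; rewrite mxE.
under eq_cvg do rewrite mxE.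
by apply: cvgM; [exact: cvg_cst|exact: coord_continuous].
Qed.

Lemma open_dilation d (A : set 'rV[R]_n) : (forall i, d 0 i != 0) -> open A ->
  open (dilation d @` A).
Proof.
move=> d0 oA; have -> : dilation d @` A = dilation (\row_i (d 0 i)^-1) @^-1` A.
  apply/seteqP; split=> [_ [y Ay <-]|y Ay].
    rewrite /preimage /= (_ : dilation _ _ = y) //.
    by apply/rowP => i; rewrite !mxE mulKf.
  exists (dilation (\row_i (d 0 i)^-1) y) => //.
  by apply/rowP => i; rewrite !mxE mulVKf.
by apply: open_comp => // y _; exact: dilation_continuous.
Qed.

Lemma monomial_chart_coord sigma m I d c : monomial_chart sigma m I d c ->
  forall p, dom c p -> Defs.coord c p = dilation d (chart_values sigma m p).
Proof.
move=> [[ds _] _ _ cU cE] p cp; have [x _ xp] := cU _ cp.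
by rewrite -xp cE ?xp // -xp (chart_valuesE fanSigma).
Qed.

Lemma monomial_chart_in sigma m I d c (W : set Y) : monomial_chart sigma m I d c ->
  dom c `<=` W -> chart_in W c.
Proof.
move=> mc cW; have cE := monomial_chart_coord mc; have [[ds mI] d0 oc cU cE'] := mc.
have Kc p : dom c p -> {for p, continuous (fun q => dilation d (chart_values sigma m
  q))}.
  move=> /cU Up; have Kp := chart_values_continuous fanSigma ds mI Up.
  have Dp := @dilation_continuous d (chart_values sigma m p).
  exact: (@cvg_comp _ _ _ _ (dilation d) _ _ _ Kp Dp).
split=> //.
- move=> p q /set_mem cp /set_mem cq; have [x _ xp] := cU _ cp;
  have [z _ zq] := cU _ cq.
  rewrite -xp -zq !cE' ?xp ?zq // => /rowP xz; rewrite -xp -zq; congr (incl _).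
  rewrite -(chart_pointK x x mI) -(chart_pointK x z mI); congr (chart_point _ _ _).
  by apply/rowP => i; have := xz i; rewrite !mxE => /(mulfI (d0 i)).
- move=> p cp; apply: near_eq_continuous_at (Kc _ cp).
  have : \forall q \near p, dom c q by exact: open_nbhs_nbhs.
  by apply: filterS => q /cE.
- move=> V oV Vc; have -> : Defs.coord c @` V = dilation d @` (chart_values sigma m
  @` V).
    by rewrite image_comp; apply: eq_imagel => p /Vc/cE.
  apply: open_dilation => //.
  by apply: (chart_values_open ds mI) => // p /Vc/cU.
Qed.

Lemma monomialM a y y' : monomial a (dilation y y') = monomial a y * monomial a y'.
Proof.
by rewrite /monomial -big_split; apply: eq_bigr => j _; rewrite mxE expfzMl.
Qed.

Lemma monomial_neq0 a y : (forall j, y 0 j != 0) -> monomial a y != 0.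
Proof. by move=> y0; apply/prodf_neq0 => j _; rewrite expfz_neq0. Qed.

Lemma vertex_values m w : m \in unitmx -> affine_points [set (0 : 'rV[R]_n)] w ->
  forall a, w a = monomial (a *m invmx m) (values m w).
Proof.
by move=> um aw a; apply: (affine_monomial (vertex_adapted_unit um) aw);
  exact: dual_monoid_set0.
Qed.

(** Undoing the rescaling by [d] inside a monomial divides it by its value at [d]. *)
Definition transition_scale m d m' d' : 'rV[R]_n :=
  \row_i (d' 0 i / monomial (row i (m' *m invmx m)) d).

(** For one cone, exponents are nonnegative on [I] and the other coordinates do not vanish. For
    distinct cones the overlap lies in the torus, where no coordinate vanishes. *)
Lemma monomial_transition sigma m I d c sigma' m' I' d' c' :
  monomial_chart sigma m I d c -> monomial_chart sigma' m' I' d' c' ->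
  smooth_transition c c'
    (monomial_map (m' *m invmx m) (transition_scale m d m' d')).
Proof.
move=> mc mc'; have := monomial_chart_in mc (@subset_refl _ _).
case=> _ _ _ _ oc; have [[ds mI] d0 od cU cE] := mc;
  have [[ds' mI'] d0' od' cU' cE'] := mc'.
have rowA i : row i (m' *m invmx m) = row i m' *m invmx m by rewrite row_mul.
split=> [p cp cp'|].
  have [x _ xp] := cU _ cp; have [x' _ xp'] := cU' _ cp'.
  have xx' : incl x = incl x' by rewrite xp xp'.
  rewrite -{1}xp -xp' cE ?xp // cE' ?xp' //.
  apply/rowP => i; rewrite !mxE monomialM mulrA divfK ?monomial_neq0 //.
  congr (_ * _); rewrite rowA.
  have [ss'|ss'] := pselect (sigma = sigma').
    subst sigma'; rewrite -(incl_inj fanSigma ds xx').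
    by rewrite (affine_monomial mI (piece_affine x)) //; exact: adapted_row mI'.
  have [w aw [xw x'w]] := distinct_charts_meet fanSigma ds ds' ss' xx'.
  rewrite x'w; last exact: adapted_row mI'.
  rewrite (vertex_values (proj1 mI) aw); congr (monomial _ _).
  by apply/rowP => j; rewrite !mxE xw //; exact: adapted_row mI.
apply: smooth_monomial_map => [|i j]; first by apply: oc;
  [exact: openI|exact: subIsetl].
have [ss'|ss'] := pselect (sigma = sigma').
  subst sigma'; have [jI|jI] := boolP (j \in I).
    left; have := (adapted_dual (row i m') mI).1 (adapted_row i mI') j jI.
    by rewrite -rowA mxE.
  right=> _ [p [cp _] <-]; have [x _ xp] := cU _ cp.
  rewrite -xp cE ?xp // mxE mulf_neq0 //.
  exact: (values_off_zero mI (piece_affine x)).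
right=> _ [p [cp cp'] <-]; have [x _ xp] := cU _ cp; have [x' _ xp'] := cU' _ cp'.
have xx' : incl x = incl x' by rewrite xp xp'.
have [w aw [xw _]] := distinct_charts_meet fanSigma ds ds' ss' xx'.
rewrite -xp cE ?xp // !mxE mulf_neq0 // xw ?vertex_neq0 //; exact: adapted_row mI.
Qed.

End ToricCharts.

(** * Transport of orientations *)

Section OrientationSign.
Context {R : realType} {n : nat} {X : topologicalType}.
Implicit Types (a c : @chart R n X) (W : set X) (p q : X) (s : R).
Variables (W : set X) (A B : set (@chart R n X)).
Hypothesis BW : forall c, B c -> chart_in W c.
Hypothesis Bcover : forall p, W p -> exists2 c, B c & dom c p.
Hypothesis Bsmooth : forall c a, B c -> A a -> smoothly_compatible c a.
Hypothesis Boriented : forall c c', B c -> B c' -> orientedly_compatible c c'.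
Hypothesis Aopen : forall a, A a -> open (dom a).

(* The orientation of W given by B is, up to a positive factor, s times the one
   of the chart a at p. *)
Definition orients a p s : Prop := exists c f, [/\ B c, dom c p, dom a p,
  smooth_transition c a f & 0 < s * \det ('J f (Defs.coord c p))].

Lemma smooth_on_differentiable (O : set 'rV[R]_n) f y :
  smooth_on O f -> O y -> differentiable f y.
Proof. by move=> sf Oy; have [df _] := sf 1; exact: df. Qed.

Lemma near_coord c (D : set X) p : B c -> open D -> D `<=` dom c -> D p ->
  \forall y \near Defs.coord c p, exists2 q, D q & Defs.coord c q = y.
Proof.
move=> Bc oD Dc Dp; have [_ _ _ _ oc] := BW Bc.
have : nbhs (Defs.coord c p) (Defs.coord c @` D).
  by apply: open_nbhs_nbhs; split; [exact: oc|exists p].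
exact.
Qed.

(** The transition functions are tied to the charts only on images of overlaps, so [f'] is compared
    with [g \o f] near the image of [p], on the triple overlap. *)
Lemma transition_comp c a a' f f' g p : B c -> open (dom a) -> open (dom a') ->
  dom c p -> dom a p -> dom a' p -> smooth_transition c a f ->
  smooth_transition c a' f' -> smooth_transition a a' g ->
  'J f' (Defs.coord c p) = 'J f (Defs.coord c p) *m 'J g (Defs.coord a p).
Proof.
move=> Bc oa oa' cp ap a'p [fE fs] [f'E f's] [gE gs].
have [oc _ _ _ _] := BW Bc.
have df : differentiable f (Defs.coord c p).
  by apply: (smooth_on_differentiable fs); exists p.
have dg : differentiable g (f (Defs.coord c p)).
  by rewrite fE //; apply: (smooth_on_differentiable gs); exists p.
have dgf : differentiable (g \o f) (Defs.coord c p) by exact: differentiable_comp df dg.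
rewrite -(fE _ cp ap); apply: (etrans _ (jacobian_comp df dg)).
suff gff' : {near Defs.coord c p, g \o f =1 f'} by exact: near_eq_jacobian gff' dgf.
have H : \forall y \near Defs.coord c p,
    exists2 q, (dom c `&` (dom a `&` dom a')) q & Defs.coord c q = y.
  by apply: near_coord => //; do !apply: openI.
near=> y.
have [q [cq [aq a'q]] <-] : exists2 q, (dom c `&` (dom a `&` dom a')) q &
  Defs.coord c q = y by near: y.
by rewrite /= fE // gE // f'E.
Unshelve. all: by end_near.
Qed.

Lemma mul_eq1_neq0 (u v : R) : 1 = u * v -> u != 0.
Proof. by apply: contra_eq_neq => ->; rewrite mul0r oner_neq0. Qed.

Lemma sqr_gt0_of_mul (u v : R) : 0 < u * v -> 0 < u * u.
Proof.
by move=> uv; rewrite -expr2 exprn_even_gt0 //=; apply: contraTneq uv => ->;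
  rewrite mul0r ltxx.
Qed.

Lemma pos_unique (s s' u v : R) : 0 < v -> 0 < s * (v * u) -> 0 < s' * u -> 0 < s * s'.
Proof.
move=> v0 svu su; have u2 : 0 < u * u by apply: (@sqr_gt0_of_mul u s'); rewrite mulrC.
rewrite -(pmulr_lgt0 _ u2) -(pmulr_lgt0 _ v0).
by have := mulr_gt0 svu su; congr (0 < _); ring.
Qed.

Lemma pos_scale (s s' u : R) : 0 < s * s' -> 0 < s * u -> 0 < s' * u.
Proof.
move=> ss su; rewrite -(pmulr_lgt0 _ (sqr_gt0_of_mul ss)).
by have := mulr_gt0 ss su; congr (0 < _); ring.
Qed.

Lemma pos_transition (s u v : R) : 0 < s * u -> v != 0 -> 0 < s * v * (u * v).
Proof.
move=> su v0; have v2 : 0 < v * v by rewrite -expr2 exprn_even_gt0.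
by have := mulr_gt0 su v2; congr (0 < _); ring.
Qed.

Lemma transition_det_neq0 c a f p : B c -> A a -> dom c p -> dom a p ->
  smooth_transition c a f -> \det ('J f (Defs.coord c p)) != 0.
Proof.
move=> Bc Aa cp ap cf; have [_ [g ag]] := Bsmooth Bc Aa.
have [oc _ _ _ _] := BW Bc.
have cid : smooth_transition c c id.
  split=> // k; apply: regular_Ck.
    by rewrite setIid; have [_ _ _ _] := BW Bc; apply.
  by move=> j; exists (fun y => y 0 j); [exact: regular_coord|].
(* Going from [c] to [a] and back is the identity, so the two determinants have product 1. *)
have := transition_comp Bc (Aopen Aa) oc cp ap cp cf cid ag.
rewrite jacobian_id => /(congr1 determinant); rewrite det1 det_mulmx.
exact: mul_eq1_neq0.
Qed.

Lemma orients_exists a p : A a -> W p -> dom a p -> exists s, orients a p s.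
Proof.
move=> Aa Wp ap; have [c Bc cp] := Bcover Wp; have [[f cf] _] := Bsmooth Bc Aa.
have d0 := transition_det_neq0 Bc Aa cp ap cf.
exists (\det ('J f (Defs.coord c p))), c, f; split=> //.
by rewrite -expr2 exprn_even_gt0.
Qed.

Lemma orients_neq0 a p s : orients a p s -> s != 0.
Proof.
by case=> [c [f [_ _ _ _]]]; apply: contraTneq => ->; rewrite mul0r ltxx.
Qed.

Lemma orients_unique a p s s' : A a -> orients a p s -> orients a p s' -> 0 < s * s'.
Proof.
move=> Aa [c [f [Bc cp ap cf sf]]] [c' [f' [Bc' c'p _ cf' sf']]].
have [phi cphi Jphi] := Boriented Bc Bc'; have [oc' _ _ _ _] := BW Bc'.
have E := transition_comp Bc oc' (Aopen Aa) cp c'p ap cphi cf cf'.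
move: sf; rewrite E det_mulmx => sf.
exact: pos_unique (Jphi p cp c'p) sf sf'.
Qed.

Lemma orients_scale a p s s' : 0 < s * s' -> orients a p s -> orients a p s'.
Proof.
move=> ss [c [f [Bc cp ap cf sf]]]; exists c, f; split=> //.
exact: pos_scale ss sf.
Qed.

Lemma open_orients a s : A a -> open [set p | orients a p s].
Proof.
move=> Aa; rewrite openE => p [c [f [Bc cp ap cf sf]]].
have [oc _ _ cc co] := BW Bc;
  have oca : open (dom c `&` dom a) by apply: openI => //; exact: Aopen.
have Jc : {for Defs.coord c p, continuous (fun y => \det ('J f y))}.
  case: (cf) => _ fs; apply: (continuous_det_jacobian _ fs); last by exists p.
  by apply: co => //; exact: subIsetl.
have h1 : \forall q \near p, (dom c `&` dom a) q by exact: open_nbhs_nbhs.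
have h2 : \forall q \near p, 0 < s * \det ('J f (Defs.coord c q)).
  have sJ : s * \det ('J f y) @[y --> Defs.coord c p] --> s * \det ('J f (Defs.coord
    c p)).
    by apply: (@cvgM _ _ (nbhs (Defs.coord c p)) _ (fun=> s));
      [exact: cvg_cst|exact: Jc].
  have oP : nbhs (s * \det ('J f (Defs.coord c p))) [set t : R | 0 < t].
    by apply: open_nbhs_nbhs; split; [exact: open_gt|].
  have nJ := sJ _ oP.
  have cpq := cc _ cp _ nJ.
  by move: cpq; rewrite !nbhs_simpl.
rewrite /interior /=; near=> q; exists c, f.
have [cq aq] : (dom c `&` dom a) q by near: q.
by split; [exact: Bc|exact: cq|exact: aq|exact: cf|near: q; exact: h2].
Unshelve. all: by end_near.
Qed.

(** On [C] the points of sign [s] and those of sign [- s] are complementary, and both conditions are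
    open. *)
Lemma orients_connected a s (C : set X) p q : A a -> connected C ->
  C `<=` W -> C `<=` dom a -> C p -> C q -> orients a p s -> orients a q s.
Proof.
move=> Aa cC CW Ca Cp Cq ps.
have s0 : s != 0 by exact: orients_neq0 ps.
suff E : C `&` [set r | orients a r s] = C.
  by have [] : (C `&` [set r | orients a r s]) q by rewrite E.
apply: cC; first by exists p.
  by exists [set r | orients a r s] => //; exact: open_orients.
exists (~` [set r | orients a r (- s)]); first by apply: open_closedC;
  exact: open_orients.
apply/seteqP; split=> r [Cr rs]; (split; first exact: Cr).
  move=> rNs; have := orients_unique Aa rs rNs.
  by rewrite mulrN oppr_gt0 -expr2 ltNge sqr_ge0.
have [s' rs'] := orients_exists Aa (CW _ Cr) (Ca _ Cr).
have s'0 : s' != 0 by exact: orients_neq0 rs'.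
have [ss'|ss'] := ltP 0 (s' * s); first exact: orients_scale rs'.
apply: contrapT => nrs; apply: rs; apply: orients_scale rs';
  rewrite mulrN oppr_gt0 lt_neqAle ss' andbT.
by rewrite mulf_neq0.
Qed.

Lemma orients_transition a a' g p s : A a -> A a' -> dom a' p ->
  smooth_transition a a' g -> \det ('J g (Defs.coord a p)) != 0 ->
  orients a p s -> orients a' p (s * \det ('J g (Defs.coord a p))).
Proof.
move=> Aa Aa' a'p ag g0 [c [f [Bc cp ap cf sf]]].
have [[f' cf'] _] := Bsmooth Bc Aa'.
have E : \det ('J f' (Defs.coord c p)) =
    \det ('J f (Defs.coord c p)) * \det ('J g (Defs.coord a p)).
  apply: (etrans _ (det_mulmx _ _)); congr (\det _).
  exact: transition_comp Bc (Aopen Aa) (Aopen Aa') cp ap a'p cf cf' ag.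
exists c, f'; split; [exact: Bc|exact: cp|exact: a'p|exact: cf'|].
by rewrite [X in _ * X]E; exact: pos_transition sf g0.
Qed.

End OrientationSign.

Section Transport.
Context {R : realType} {n : nat} (Sigma : set (set 'rV[R]_n)).
Hypothesis fanSigma : rational_fan Sigma.
Hypothesis S0 : Sigma [set 0].
Implicit Types (sigma tau : Sigma) (a b : 'rV[int]_n) (m : 'M[int]_n) (I : {set 'I_n}).
Implicit Types (u : 'rV['F_2]_n).

Notation piece sigma := (set_type (affine_points (val sigma))).
Notation incl := (@affine_inclusion R n Sigma _).
Notation Y := (real_toric_variety Sigma).
Notation M := (@toric_open_part R n Sigma).

Definition vertex : Sigma := exist _ [set 0] (mem_set S0).

Lemma vertex_sub sigma : dim_le1 (val sigma) -> val vertex `<=` val sigma.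
Proof.
case=> [->//|[b b0 ->]] _ /= ->.
by exists 0; rewrite /= ?scale0r.
Qed.

Lemma vertex_dim : dim_le1 (val vertex).
Proof. by left. Qed.

Definition atlas_chart sigma m : @chart R n Y :=
  Chart (range (fun x : piece sigma => incl x)) (chart_values sigma m).

Lemma atlas_chart_monomial sigma m I : dim_le1 (val sigma) -> adapted_on (val sigma)
  m I ->
  monomial_chart sigma m I (const_mx 1) (atlas_chart sigma m).
Proof.
move=> ds mI; split=> //=.
- by move=> i; rewrite mxE oner_neq0.
- exact: open_range_incl.
- move=> x _; rewrite (chart_valuesE fanSigma) //.
  by apply/rowP => i; rewrite !mxE mul1r.
Qed.

Lemma atlas_chart_toric sigma m I : dim_le1 (val sigma) -> adapted_on (val sigma) m I ->
  toric_atlas (atlas_chart sigma m).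
Proof.
move=> ds [um mI]; exists sigma, m; split=> //; first by split=> //; exists I.
by move=> x; rewrite /= (chart_valuesE fanSigma).
Qed.

(** The torus point with coordinates (-1)^u: one representative in each orthant. *)
Definition sign_point u : {ptws 'rV[int]_n -> R} :=
  fun a => (sgF2 ((modF2 a *m u^T) 0 0))%:~R.

Lemma modF2D a b : modF2 (a + b) = modF2 a + modF2 b.
Proof. by rewrite /modF2 map_mxD. Qed.

Lemma sign_point_affine u : affine_points [set (0 : 'rV[R]_n)] (sign_point u).
Proof.
split.
- by rewrite /sign_point /modF2 map_mx0 mul0mx mxE.
- by move=> a b _ _; rewrite /sign_point modF2D mulmxDl mxE sgF2D intrM.
- by move=> a []; exact: dual_monoid_set0.
Qed.

Definition torus_point u : piece vertex := exist _ (sign_point u) (mem_set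
  (sign_point_affine u)).

Lemma torus_point_in sigma u : dim_le1 (val sigma) ->
  exists2 x : piece sigma, incl x = incl (torus_point u) &
    forall a, dual_monoid (val sigma) a -> val x a = sign_point u a.
Proof.
move=> ds; have aw := affine_restrict (vertex_sub ds) (sign_point_affine u).
exists (piece_of aw) => [|a sa]; last by rewrite /= dual_restrictE.
by apply: incl_restrict => [|a sa]; [exact: vertex_sub|rewrite /= dual_restrictE].
Qed.

Lemma chart_values_torus sigma m I u : dim_le1 (val sigma) -> adapted_on (val sigma)
  m I ->
  chart_values sigma m (incl (torus_point u)) = \row_i sign_point u (row i m).
Proof.
move=> ds mI; have [x <- xE] := torus_point_in u ds.
rewrite (chart_valuesE fanSigma) //; apply/rowP => i; rewrite !mxE xE //.
exact: adapted_row mI.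
Qed.

(** The sign relating dx_1 ... dx_n to dx_1/x_1 ... dx_n/x_n in the coordinates given by [m]. *)
Definition orthant_sign m u : R := \prod_i sign_point u (row i m).

Lemma orthant_sign_sqr m u : orthant_sign m u * orthant_sign m u = 1.
Proof.
rewrite /orthant_sign -big_split big1 // => i _ /=.
rewrite /sign_point -intrM /sgF2.
by case: ((modF2 _ *m _) 0 0) => [[|[|//]] ?].
Qed.

(** The coordinates of a sign point are their own inverses, so the quotients in the Jacobian formula
    become products. *)
Lemma torus_transition sigma m I u : dim_le1 (val sigma) -> adapted_on (val sigma) m
  I ->
  exists2 g, smooth_transition (atlas_chart vertex 1%:M) (atlas_chart sigma m) g &
    \det ('J g (Defs.coord (atlas_chart vertex 1%:M) (incl (torus_point u)))) =
    (\det m)%:~R * orthant_sign m u * orthant_sign 1%:M u.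
Proof.
move=> ds mI; have m0 := atlas_chart_monomial vertex_dim (@vertex_adapted R n).
have g01 := monomial_transition fanSigma m0 (atlas_chart_monomial ds mI).
eexists; first exact: g01.
have [x xE _] := torus_point_in u ds.
have c0 : dom (atlas_chart vertex 1%:M) (incl (torus_point u)) by exists (torus_point
  u).
have c1 : dom (atlas_chart sigma m) (incl (torus_point u)) by exists x.
have y0 : Defs.coord (atlas_chart vertex 1%:M) (incl (torus_point u)) =
    \row_i sign_point u (row i 1%:M).
  exact: chart_values_torus vertex_dim (@vertex_adapted R n).
have y1 : Defs.coord (atlas_chart sigma m) (incl (torus_point u)) =
    \row_i sign_point u (row i m) by exact: chart_values_torus ds mI.
rewrite det_jacobian_monomial_map.
  rewrite g01.1 // y1 y0 invmx1 mulmx1 -mulrA; congr (_ * _).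
  rewrite /orthant_sign -big_split; apply: eq_bigr => i _; rewrite !mxE /=;
    congr (_ * _).
  rewrite /sign_point /sgF2.
  by case: ((modF2 _ *m _) 0 0) => [[|[|//]] ?] /=;
    rewrite ?expr0 ?expr1 ?mulrN1z ?invrN1 ?invr1.
by move=> j; rewrite y0 mxE; exact: vertex_neq0 (sign_point_affine u).
Qed.

Lemma wall_signs m b i u j : b *m m^T = delta_mx 0 i ->
  sign_point (u + modF2 b) (row j m) = (if j == i then -1 else 1) * sign_point u (row
    j m).
Proof.
move=> mb; rewrite /sign_point linearD /= mulmxDr mxE sgF2D intrM mulrC; congr (_ * _).
have -> : (modF2 (row j m) *m (modF2 b)^T) 0 0 = ((b *m m^T) 0 j)%:~R.
  rewrite mxE [in RHS]mxE rmorph_sum; apply: eq_bigr => l _.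
  by rewrite !mxE rmorphM mulrC.
by rewrite mb !mxE eqxx; case: (j == i).
Qed.

Lemma orthant_sign_wall m b i u : b *m m^T = delta_mx 0 i ->
  orthant_sign m (u + modF2 b) = - orthant_sign m u.
Proof.
move=> mb; rewrite /orthant_sign (bigD1 i) //= [in RHS](bigD1 i) //=.
rewrite (wall_signs u i mb) eqxx mulN1r mulNr; congr (- (_ * _)).
by apply: eq_bigr => j ji; rewrite (wall_signs u j mb) (negPf ji) mul1r.
Qed.

Section OrientedAtlas.
Variables (p0 : Y) (B : set (@chart R n Y)).
Let W := connected_component M p0.
Hypothesis BW : forall c, B c -> chart_in W c.
Hypothesis Bcover : forall p, W p -> exists2 c, B c & dom c p.
Hypothesis Bsmooth : forall c (c' : @chart R n Y), B c -> toric_atlas c' ->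
  smoothly_compatible c c'.
Hypothesis Boriented : forall c c', B c -> B c' -> orientedly_compatible c c'.

Let a0 := atlas_chart vertex 1%:M.

Lemma toric_atlas_open (a : @chart R n Y) : toric_atlas a -> open (dom a).
Proof.
by move=> /(toric_monomial_chart fanSigma)[sigma [m [I [[_ _ oa _ _] _]]]].
Qed.

(** The factor [orthant_sign 1%:M] makes [s] the sign relative to dx_1/x_1 ... dx_n/x_n. In the
    chart of the ray the orientation has the same sign at both ends of the segment; converting back
    brings in [orthant_sign m], which changes across the wall. *)
Lemma orients_wall sigma m b i u (s : R) : is_ray (val sigma) ->
  ray_basis (val sigma) m b i -> W (incl (torus_point u)) ->
  orients B a0 (incl (torus_point u)) (s * orthant_sign 1%:M u) ->
  W (incl (torus_point (u + modF2 b))) /\ orients B a0 (incl (torus_point (u + modF2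
    b))) (- s * orthant_sign 1%:M (u + modF2 b)).
Proof.
move=> rs mbi Wu us; have ds : dim_le1 (val sigma) by right.
have mI := ray_basis_adapted mbi; have [um mb _] := mbi.
pose u' := u + modF2 b; rewrite -/u'.
have [x xE xw] := torus_point_in u ds; have [x' x'E x'w] := torus_point_in u' ds.
have [C [cC Cx Cx' CU]] : exists C : set Y, [/\ connected C, C (incl x), C (incl x') &
    C `<=` range (fun z : piece sigma => incl z)].
  apply: (orthant_connected mI) => j; rewrite inE => ji; rewrite !mxE xw ?x'w;
    try exact: adapted_row mI.
  rewrite /u' (wall_signs u j mb) (negPf ji) mul1r -expr2 exprn_even_gt0 //=.
  exact: vertex_neq0 (sign_point_affine u).
rewrite xE in Cx; rewrite x'E in Cx'.
have CW : C `<=` W.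
  move=> q Cq; apply: connected_component_trans Wu _.
  exists C => //; split=> //.
  by apply: subset_trans CU _; exact: range_open_part.
have Wu' : W (incl (torus_point u')) by exact: CW.
split; first exact: Wu'.
have A0 := atlas_chart_toric vertex_dim (@vertex_adapted R n) : toric_atlas a0.
have A1 := atlas_chart_toric ds mI.
have d0 : (\det m)%:~R != 0 :> R.
  rewrite intr_eq0; apply: contraTneq um => d0; rewrite unitmxE d0.
  by rewrite unitr0.
have e0 v m' : orthant_sign m' v != 0.
  by apply: contra_eq_neq (orthant_sign_sqr m' v) => ->; rewrite mul0r eq_sym oner_neq0.
have trans v s' : W (incl (torus_point v)) -> orients B a0 (incl (torus_point v)) s' ->
    orients B (atlas_chart sigma m) (incl (torus_point v))
      (s' * ((\det m)%:~R * orthant_sign m v * orthant_sign 1%:M v)).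
  move=> Wv vs; have [g ag gE] := torus_transition v ds mI.
  rewrite -gE; have [z zE _] := torus_point_in v ds.
  apply: (orients_transition BW Bsmooth toric_atlas_open A0 A1 _ ag _ vs).
    by exists z.
  by rewrite gE !mulf_neq0.
have h1 := trans _ _ Wu us.
have h2 := orients_connected BW Bcover Bsmooth Boriented toric_atlas_open A1 cC CW CU
  Cx Cx' h1.
have [s' us'] := orients_exists BW Bcover Bsmooth toric_atlas_open A0 Wu' (ex_intro2
  _ _ (torus_point u') I erefl).
have h3 := orients_unique BW Boriented toric_atlas_open A1 h2 (trans _ _ Wu' us').
apply: orients_scale us'.
move: h3; rewrite {1}/u' (orthant_sign_wall u mb).
have := orthant_sign_sqr 1%:M u; have := orthant_sign_sqr 1%:M u';
  have := orthant_sign_sqr m u.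
have := d0; move: (orthant_sign m u) (orthant_sign 1%:M u) (orthant_sign 1%:M u')
  ((\det m)%:~R).
move=> e f g d d0' ee gg ff h.
have d2 : 0 < d * d by rewrite -expr2 exprn_even_gt0.
rewrite -(pmulr_lgt0 _ d2).
suff -> : s' * (- s * g) * (d * d) = s * f * (d * e * f) * (s' * (d * - e * g)) by [].
transitivity (s' * (- s * g) * (d * d) * (e * e) * (f * f));
  first by rewrite ee ff !mulr1.
ring.
Qed.

(** Each generator in the list is one wall crossing. A list with sum 0 returns to the starting
    point, and an odd number of sign changes contradicts the uniqueness of the sign. *)
Lemma no_odd_relation (s : seq 'rV[int]_n) : W (incl (torus_point 0)) ->
  (forall b, b \in s -> exists sigma m i, is_ray (val sigma) /\ ray_basis (val sigma)
    m b i) ->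
  odd (size s) -> \sum_(b <- s) modF2 b <> 0.
Proof.
move=> W0 sP os s0.
have A0 := atlas_chart_toric vertex_dim (@vertex_adapted R n) : toric_atlas a0.
have [t ot] := orients_exists BW Bcover Bsmooth toric_atlas_open A0 W0 (ex_intro2 _ _
  (torus_point 0) I erefl).
have t1 : orients B a0 (incl (torus_point 0)) (t * orthant_sign 1%:M 0 * orthant_sign
  1%:M 0).
  by rewrite -mulrA orthant_sign_sqr mulr1.
have : W (incl (torus_point (\sum_(b <- s) modF2 b))) /\
    orients B a0 (incl (torus_point (\sum_(b <- s) modF2 b)))
    ((-1) ^+ size s * (t * orthant_sign 1%:M 0) * orthant_sign 1%:M (\sum_(b <- s)
      modF2 b)).
  elim: s sP {os s0} => [_|b s IH sP]; first by rewrite big_nil mul1r.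
  have [sigma [m [i [rs mbi]]]] := sP b (mem_head _ _).
  have [|Ws os] := IH; first by move=> c cs; apply: sP; rewrite inE cs orbT.
  rewrite big_cons addrC exprS mulN1r mulNr.
  exact: orients_wall rs mbi Ws os.
rewrite s0 -signr_odd os expr1 mulN1r => -[_ t2].
have := orients_unique BW Boriented toric_atlas_open A0 t1 t2.
by rewrite mulNr mulrN oppr_gt0 -expr2 ltNge sqr_ge0.
Qed.

End OrientedAtlas.

End Transport.

(** * Oriented atlases *)

Lemma det_dim0 (T : comNzRingType) n (A : 'M[T]_n) : n = 0%N -> \det A = 1.
Proof. by move=> n0; move: A; rewrite n0 => A; exact: det_mx00. Qed.

Section OrientedCharts.
Context {R : realType} {n : nat} (Sigma : set (set 'rV[R]_n)).
Hypothesis fanSigma : rational_fan Sigma.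
Implicit Types (sigma tau : Sigma) (a b : 'rV[int]_n) (m : 'M[int]_n) (I : {set 'I_n}).
Implicit Types (w v : {ptws 'rV[int]_n -> R}).

Notation piece sigma := (set_type (affine_points (val sigma))).
Notation incl := (@affine_inclusion R n Sigma _).
Notation Y := (real_toric_variety Sigma).
Notation M := (@toric_open_part R n Sigma).

Variable h : 'cV['F_2]_n.
Hypothesis h_odd : forall sigma m b i, is_ray (val sigma) -> ray_basis (val sigma) m
  b i ->
  modF2 b *m h = 1%:M.

Definition basis_frame sigma m I : Prop :=
  [/\ val sigma = [set 0], m = 1%:M & I = finset.set0] \/
  is_ray (val sigma) /\ exists b i, ray_basis (val sigma) m b i /\ I = [set i]%SET.

Lemma basis_frame_exists sigma : dim_le1 (val sigma) ->
  exists mI : 'M[int]_n * {set 'I_n}, basis_frame sigma mI.1 mI.2.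
Proof.
case=> [s0|rs]; first by exists (1%:M, finset.set0); left.
have [m [b [i mbi]]] := ray_basis_exists rs.
by exists (m, [set i]%SET); right; split=> //; exists b, i.
Qed.

Lemma basis_frame_adapted sigma m I :
  basis_frame sigma m I -> adapted_on (val sigma) m I.
Proof.
case=> [[-> -> ->]|[_ [b [i [mbi ->]]]]]; first exact: vertex_adapted.
exact: ray_basis_adapted mbi.
Qed.

(* The density, up to a positive factor and in the coordinates given by m, of the
   volume form (-1)^h(s) dx_1/x_1 ... dx_n/x_n, where (-1)^s is the sign vector of
   x. *)
Definition orientation m w : R :=
  (\det m)%:~R * \prod_i w (row i m) * \prod_(j | h j 0 != 0) w (delta_mx 0 j).

Lemma signz_F2 (z : int) : (-1) ^ z = (sgF2 z%:~R)%:~R :> R.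
Proof.
rewrite sgF2_int; case: z => k;
  first by rewrite -[RHS]/(((-1) ^+ k)%:~R) rmorphXn rmorphN1.
rewrite -[LHS]/(((-1) ^+ k.+1)^-1) -[(-1) ^ _ in RHS]/(((-1) ^+ k.+1)^-1).
by rewrite -!exprVn !invrN1 rmorphXn rmorphN1.
Qed.

Lemma unit_det_neq0 m : m \in unitmx -> (\det m)%:~R != 0 :> R.
Proof.
move=> um; rewrite intr_eq0; apply: contraTneq um => d0.
by rewrite unitmxE d0 unitr0.
Qed.

Lemma orientation_neq0 m w : m \in unitmx -> affine_points [set (0 : 'rV[R]_n)] w ->
  orientation m w != 0.
Proof.
move=> um aw; rewrite !mulf_neq0 ?unit_det_neq0 //.
  by apply/prodf_neq0 => i _; exact: vertex_neq0.
by apply/prodf_neq0 => i _; exact: vertex_neq0.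
Qed.

Lemma sgr_prod (I : finType) (P : pred I) (F : I -> R) :
  Num.sg (\prod_(i | P i) F i) = \prod_(i | P i) Num.sg (F i).
Proof. by apply: (big_morph Num.sg (@sgrM _) (sgr1 _)). Qed.

(* Crossing the wall of a ray changes the sign of one coordinate and, as h is odd
   on the ray, that of the last factor. *)
Lemma orientation_const sigma m I w v : basis_frame sigma m I ->
  affine_points [set (0 : 'rV[R]_n)] w -> affine_points [set (0 : 'rV[R]_n)] v ->
  (forall i, i \notin I -> 0 < w (row i m) * v (row i m)) ->
  0 < orientation m w * orientation m v.
Proof.
move=> fr aw av wv; have [um _] := basis_frame_adapted fr.
(* The sign of the quotient of the two torus points is again a torus point, which reduces the claim
   to a computation with signs. *)
pose s : {ptws 'rV[int]_n -> R} := fun a => Num.sg (w a * v a).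
have as_ : affine_points [set (0 : 'rV[R]_n)] s.
  split.
  - by rewrite /s (affine1 aw) (affine1 av) mulr1 sgr1.
  - move=> a b sa sb; rewrite /s (affineD aw sa sb) (affineD av sa sb).
    by rewrite mulrACA sgrM.
  - by move=> a []; exact: dual_monoid_set0.
have sI i : i \notin I -> s (row i m) = 1 by move=> /wv; rewrite /s => /gtr0_sg.
rewrite -sgr_gt0.
have -> : Num.sg (orientation m w * orientation m v) =
    (\prod_i s (row i m)) * \prod_(j | h j 0 != 0) s (delta_mx 0 j).
  rewrite /orientation mulrACA [X in X * _]mulrACA !sgrM /s.
  rewrite -mulrA -[RHS]mul1r; congr (_ * (_ * _)).
  - by rewrite -sgrM gtr0_sg // -expr2 exprn_even_gt0 //= unit_det_neq0.
  - by rewrite -sgrM -big_split sgr_prod.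
  - by rewrite -sgrM -big_split sgr_prod.
case: fr => [[s0 m1 I0]|[rs [b [i [mbi Ii]]]]].
  rewrite !big1 ?mulr1 //.
    by move=> j _; rewrite -row1 -m1 sI // I0 inE.
  by move=> j _; rewrite sI // I0 inE.
(* Only coordinate [i] of [s] can differ from 1, and its exponent in [a] is the pairing of [a] with
   [b]. *)
have sE a : s a = s (row i m) ^ ((a *m b^T) 0 0).
  rewrite (vertex_values um as_) /monomial (bigD1 i) //= big1 ?mulr1 => [|j ji].
    by rewrite mxE -(ray_basis_mul (a *m invmx m) mbi) mulmxKV.
  by rewrite mxE sI ?exp1rz // Ii inE.
rewrite (bigD1 i) //= [X in _ * X * _]big1 ?mulr1; last first.
  by move=> j ji; rewrite sI // Ii inE.
have sj j : s (delta_mx 0 j) = s (row i m) ^ (b 0 j).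
  by rewrite sE -rowE !mxE.
under eq_bigr do rewrite sj.
have : s (row i m) != 0 by exact: vertex_neq0.
rewrite /s; case: sgrP => [_|_ _|_ _]; first by rewrite eqxx.
  by rewrite big1 ?mulr1 // => j _; rewrite exp1rz.
under eq_bigr do rewrite signz_F2.
rewrite -rmorph_prod -sgF2_sum.
(* This sum is the value of [h] on [b], so the second product is -1 and cancels the sign of
   coordinate [i]. *)
have -> : \sum_(j | h j 0 != 0) (b 0 j)%:~R = 1 :> 'F_2.
  have /matrixP/(_ 0 0) := h_odd rs mbi; rewrite !mxE eqxx => h1; apply: (etrans _ h1).
  rewrite big_mkcond; apply: eq_bigr => j _; rewrite !mxE.
  by case: eqVneq => [->|/F2_neq0 ->]; rewrite ?mulr0 ?mulr1.
by rewrite mulN1r /sgF2 /= expr1 mulrN1z opprK.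
Qed.

(** Reversing a single coordinate suffices to make the chart agree with the orientation. *)
Definition flip m w : 'rV[R]_n :=
  \row_i (if i == 0 :> nat then Num.sg (orientation m w) else 1).

(** The torus point [w] only selects signs. For a ray the coordinate in [I] is left free, so the
    domain consists of two orthants and the wall between them. *)
Definition orthant_chart sigma m I w : @chart R n Y :=
  Chart [set p | range (fun x : piece sigma => incl x) p /\
      forall i, i \notin I -> 0 < chart_values sigma m p 0 i * w (row i m)]
    (fun p => dilation (flip m w) (chart_values sigma m p)).

Lemma orthant_chart_monomial sigma m I w : dim_le1 (val sigma) ->
  adapted_on (val sigma) m I -> affine_points [set (0 : 'rV[R]_n)] w ->
  monomial_chart sigma m I (flip m w) (orthant_chart sigma m I w).
Proof.
move=> ds mI aw; split=> //=.
- move=> i; rewrite mxE; case: ifP => _; last exact: oner_neq0.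
  by rewrite sgr_eq0 orientation_neq0 //; case: mI.
- rewrite openE => p [Up pI].
  have h1 : \forall q \near p, range (fun x : piece sigma => incl x) q.
    by apply: open_nbhs_nbhs; split=> //; exact: open_range_incl.
  have h2 : \forall q \near p, forall i, i \notin I -> 0 < chart_values sigma m q 0 i
    * w (row i m).
    apply: (@filter_forall Y _ (fun i q => i \notin I ->
      0 < chart_values sigma m q 0 i * w (row i m)) _ (nbhs_filter p)).
    move=> i; have [iI|iI] := boolP (i \in I); first by near=> q.
    have c1 : chart_values sigma m q 0 i @[q --> p] --> chart_values sigma m p 0 i.
      apply: (@cvg_comp _ _ _ (chart_values sigma m) (fun y : 'rV[R]_n => y 0 i)).
        exact: chart_values_continuous mI Up.
      exact: coord_continuous.
    have c2 : chart_values sigma m q 0 i * w (row i m) @[q --> p] -->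
        chart_values sigma m p 0 i * w (row i m).
      apply: (@cvgM _ _ (nbhs p) _ (fun q => chart_values sigma m q 0 i)
        (fun=> w (row i m))); [exact: c1|exact: cvg_cst].
    have oP : nbhs (chart_values sigma m p 0 i * w (row i m)) [set t : R | 0 < t].
      by apply: open_nbhs_nbhs; split; [exact: open_gt|exact: pI].
    have c3 := c2 _ oP; near=> q => _.
    by near: q; exact: c3.
  by rewrite /interior /=; near=> q; split; near: q.
- by move=> p [].
- by move=> x _; rewrite (chart_valuesE fanSigma).
Unshelve. all: by end_near.
Qed.

Lemma orthant_chart_component sigma m I w p q : dim_le1 (val sigma) ->
  adapted_on (val sigma) m I ->
  dom (orthant_chart sigma m I w) p -> dom (orthant_chart sigma m I w) q ->
  connected_component M p q.
Proof.
move=> ds mI [[x _ xp] pI] [[z _ zq] qI].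
have [C [cC Cx Cz CU]] : exists C : set Y, [/\ connected C, C (incl x), C (incl z) &
    C `<=` range (fun z : piece sigma => incl z)].
  apply: (orthant_connected mI) => i iI.
  have := mulr_gt0 (pI i iI) (qI i iI); rewrite -xp -zq !(chart_valuesE fanSigma) //.
  rewrite mulrACA => h0; rewrite -(pmulr_lgt0 _ (_ : 0 < w (row i m) * w (row i m))) //.
  by apply: (@sqr_gt0_of_mul _ _ (chart_values sigma m p 0 i)); rewrite mulrC;
    exact: pI.
rewrite xp in Cx; rewrite zq in Cz; exists C => //; split=> //.
by apply: subset_trans CU _; exact: range_open_part.
Qed.

Lemma prod_flip m w : m \in unitmx -> affine_points [set (0 : 'rV[R]_n)] w ->
  0 < \prod_i flip m w 0 i * orientation m w.
Proof.
move=> um aw; have o0 := orientation_neq0 um aw.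
have [n0|n0] := posnP n.
  have e (F : 'I_n -> R) (P : pred 'I_n) : \prod_(i | P i) F i = 1.
    by rewrite big1 // => i; have := ltn_ord i; rewrite {2}n0.
  rewrite e mul1r /orientation !e !mulr1.
  by rewrite det_dim0 // ltr01.
rewrite (bigD1 (Ordinal n0)) //= big1 => [|i].
  by rewrite mulr1 mxE eqxx -normrEsg normr_gt0.
by rewrite mxE -val_eqE /= => /negPf ->.
Qed.

End OrientedCharts.

Section Sufficiency.
Context {R : realType} {n : nat} (Sigma : set (set 'rV[R]_n)).
Hypothesis fanSigma : rational_fan Sigma.
Implicit Types (sigma tau : Sigma) (a b : 'rV[int]_n) (m : 'M[int]_n) (I : {set 'I_n}).
Implicit Types (w v : {ptws 'rV[int]_n -> R}).

Notation piece sigma := (set_type (affine_points (val sigma))).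
Notation incl := (@affine_inclusion R n Sigma _).
Notation Y := (real_toric_variety Sigma).
Notation M := (@toric_open_part R n Sigma).

(** The sign of a Jacobian in the torus: [d], [d'] are determinants of bases, [p], [p'] products of
    coordinates, [q], [q'] the flips, and [t] the factor from [h], which both charts share and which
    drops out as a square. *)
Lemma pos_quotient (d d' p p' q q' t : R) :
  0 < q * (d * p * t) -> 0 < q' * (d' * p' * t) -> 0 < (d' / d) * ((q' * p') / (q * p)).
Proof.
move=> h h'; have h2 := mulr_gt0 h h'.
have t2 : 0 < t * t by apply: (@sqr_gt0_of_mul _ t (q * (d * p))); rewrite mulrC -mulrA.
have [q0 d0 p0] : [/\ q != 0, d != 0 & p != 0].
  by split; apply: contraTneq h => ->; rewrite ?(mul0r, mulr0) ltxx.
have k2 : 0 < (d * q * p) * (d * q * p).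
  by rewrite -expr2 exprn_even_gt0 //= !mulf_neq0.
rewrite -(pmulr_lgt0 _ k2) -(pmulr_lgt0 _ t2).
suff <- : q * (d * p * t) * (q' * (d' * p' * t)) =
  d' / d * (q' * p' / (q * p)) * (d * q * p * (d * q * p)) * (t * t) by [].
by field; rewrite q0 d0 p0.
Qed.

Lemma sgr_eq_of_mul (x y : R) : 0 < x * y -> Num.sg x = Num.sg y.
Proof.
case: (ltrgt0P x) => [x0|x0|->]; last by rewrite mul0r ltxx.
  by rewrite (pmulr_rgt0 _ x0) => y0; rewrite !gtr0_sg.
by rewrite (nmulr_rgt0 _ x0) => y0; rewrite !ltr0_sg.
Qed.

Lemma chart_values_vertex sigma m I (x : piece sigma) w : dim_le1 (val sigma) ->
  adapted_on (val sigma) m I -> (forall a, dual_monoid (val sigma) a -> val x a = w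
    a) ->
  chart_values sigma m (incl x) = \row_i w (row i m).
Proof.
move=> ds mI xw; rewrite (chart_valuesE fanSigma) //; apply/rowP => i.
by rewrite !mxE xw //; exact: adapted_row mI.
Qed.

(** Extends [prod_flip] from the marking [w] to every torus point of the chart, on either side of
    the wall. *)
Lemma flip_orientation h sigma m I w v (p : Y) :
  (forall sigma m b i, is_ray (val sigma) -> ray_basis (val sigma) m b i ->
     modF2 b *m h = 1%:M) ->
  basis_frame sigma m I -> affine_points [set (0 : 'rV[R]_n)] w ->
  affine_points [set (0 : 'rV[R]_n)] v -> dom (orthant_chart h sigma m I w) p ->
  chart_values sigma m p = \row_i v (row i m) ->
  0 < \prod_i flip h m w 0 i * orientation h m v.
Proof.
move=> h_odd fr aw av [_ pI] pv; have [um _] := basis_frame_adapted fr.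
have ov : 0 < orientation h m w * orientation h m v.
  apply: (orientation_const h_odd fr aw av) => i iI.
  by have := pI i iI; rewrite pv mxE mulrC.
rewrite -(pmulr_lgt0 _ (sqr_gt0_of_mul ov)).
by have := mulr_gt0 (prod_flip h um aw) ov; congr (0 < _); ring.
Qed.

Lemma odd_functional_oriented (h : 'cV['F_2]_n) (p0 : Y) :
  (forall sigma m b i, is_ray (val sigma) -> ray_basis (val sigma) m b i ->
     modF2 b *m h = 1%:M) ->
  has_oriented_atlas (@toric_atlas R n Sigma) (connected_component M p0).
Proof.
move=> h_odd; set W := connected_component M p0.
have /choice[F FP] : forall sigma, exists mI : 'M[int]_n * {set 'I_n},
    dim_le1 (val sigma) -> basis_frame sigma mI.1 mI.2.
  move=> sigma; have [/basis_frame_exists[mI ?]|nd] := pselect (dim_le1 (val sigma)).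
    by exists mI.
  by exists (1%:M, finset.set0).
have FA sigma : dim_le1 (val sigma) -> adapted_on (val sigma) (F sigma).1 (F sigma).2.
  by move=> /FP/basis_frame_adapted.
pose oc sigma w : @chart R n Y := orthant_chart h sigma (F sigma).1 (F sigma).2 w.
have ocM sigma w : dim_le1 (val sigma) -> affine_points [set 0] w ->
    monomial_chart sigma (F sigma).1 (F sigma).2 (flip h (F sigma).1 w) (oc sigma w).
  by move=> ds aw; exact: orthant_chart_monomial (FA _ ds) aw.
exists [set c | exists sigma w, [/\ dim_le1 (val sigma), affine_points [set 0] w,
  dom c `<=` W & c = oc sigma w]]; split.
- move=> c [sigma [w [ds aw cW cE]]]; apply: (monomial_chart_in fanSigma _ cW).
  by rewrite cE; exact: ocM.
- move=> p Wp; have Mp : M p by exact: connected_component_sub Wp.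
  have [sigma [x [ds xp]]] := open_part_range Mp; have mI := FA _ ds.
  have [um _] := mI; pose m := (F sigma).1; pose I := (F sigma).2.
  (* The point [p] may lie on the wall; replacing its coordinate in [I] by 1 yields a torus point to
     mark the chart. *)
  pose y : 'rV[R]_n := \row_i (if i \in I then 1 else values m (val x) 0 i).
  have yI := values_off_zero mI (piece_affine x).
  have aw : affine_points [set (0 : 'rV[R]_n)] (point_of [set 0] m y).
    apply: (affine_point_of (vertex_adapted_unit um)) => i _; rewrite mxE.
    by case: ifPn => [_|/yI //]; exact: oner_neq0.
  have wE i : point_of [set (0 : 'rV[R]_n)] m y (row i m) = y 0 i.
    by have /rowP/(_ i) := values_point_of y (vertex_adapted_unit um : adapted_on
      [set (0 : 'rV[R]_n)] _ _); rewrite mxE.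
  have pd : dom (oc sigma (point_of [set 0] m y)) p.
    split=> [|i iI]; first by exists x.
    rewrite wE mxE (negPf iI) -xp (chart_valuesE fanSigma) //.
    by rewrite -expr2 exprn_even_gt0 //= yI.
  exists (oc sigma (point_of [set 0] m y)) => //.
  exists sigma, (point_of [set 0] m y); split=> // q qd.
  apply: connected_component_trans Wp _.
  exact: (orthant_chart_component fanSigma ds mI pd qd).
- move=> c c' [sigma [w [ds aw cW ->]]] /(toric_monomial_chart fanSigma).
  move=> [sigma' [m' [I' [mc' _]]]].
  have mc := ocM _ _ ds aw; split.
    exact: ex_intro (monomial_transition fanSigma mc mc').
  exact: ex_intro (monomial_transition fanSigma mc' mc).
- move=> c c' [sigma [w [ds aw cW cE]]] [sigma' [w' [ds' aw' cW' cE']]].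
  have mc := ocM _ _ ds aw; have mc' := ocM _ _ ds' aw'.
  rewrite -cE in mc; rewrite -cE' in mc'.
  have cc' := monomial_transition fanSigma mc mc'.
  (* For distinct cones all coordinates are nonzero on the overlap and the Jacobian formula applies.
     For one cone wall points may occur, but charts that meet have equal flips, so their coordinates
     coincide. *)
  have [ss'|ss'] := pselect (sigma = sigma'); last first.
    eexists; first exact: cc'.
    move=> p cp cp'; have [_ _ _ cU cv] := mc; have [_ _ _ cU' cv'] := mc'.
    have [x _ xp] := cU _ cp; have [x' _ xp'] := cU' _ cp'.
    have xx' : incl x = incl x' by rewrite xp xp'.
    have [v av [xv x'v]] := distinct_charts_meet fanSigma ds ds' ss' xx'.
    have K := chart_values_vertex ds (FA _ ds) xv.
    have K' := chart_values_vertex ds' (FA _ ds') x'v.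
    have y0 i : Defs.coord c p 0 i = flip h (F sigma).1 w 0 i * v (row i (F sigma).1).
      by rewrite (monomial_chart_coord fanSigma mc cp) -xp K !mxE.
    have y1 i : Defs.coord c' p 0 i = flip h (F sigma').1 w' 0 i * v (row i (F
      sigma').1).
      by rewrite (monomial_chart_coord fanSigma mc' cp') -xp' K' !mxE.
    have f0 : forall i, flip h (F sigma).1 w 0 i != 0 by case: mc.
    rewrite det_jacobian_monomial_map; last first.
      by move=> j; rewrite y0 mulf_neq0 //; exact: vertex_neq0.
    rewrite cc'.1 //.
    under eq_bigr do rewrite y0 y1.
    have um := (FA _ ds).1; have um' := (FA _ ds').1.
    have -> : (\det ((F sigma').1 *m invmx (F sigma).1))%:~R =
        (\det (F sigma').1)%:~R / (\det (F sigma).1)%:~R :> R.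
      by rewrite -[LHS](mulfK (@unit_det_neq0 R _ _ um)) -intrM -det_mulmx mulmxKV.
    rewrite prodf_div !big_split /=.
    have vE := chart_values_vertex ds (FA _ ds) xv;
      have v'E := chart_values_vertex ds' (FA _ ds') x'v.
    rewrite xp in vE; rewrite xp' in v'E.
    rewrite cE in cp; rewrite cE' in cp'.
    exact: pos_quotient (flip_orientation h_odd (FP _ ds) aw av cp vE)
      (flip_orientation h_odd (FP _ ds') aw' av cp' v'E).
  subst sigma'.
  have [[p [cp cp']]|ncc] := pselect (exists p, dom c p /\ dom c' p); last first.
    by eexists; [exact: cc'|move=> p cp cp'; case: ncc; exists p].
  have fr := FP _ ds.
  have ww i : i \notin (F sigma).2 -> 0 < w (row i (F sigma).1) * w' (row i (F
    sigma).1).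
    move=> iI; rewrite cE in cp; rewrite cE' in cp'.
    have hi := cp.2 i iI; have hi' := cp'.2 i iI.
    rewrite -(pmulr_lgt0 _ (sqr_gt0_of_mul hi)).
    by have := mulr_gt0 hi hi'; congr (0 < _); ring.
  have oo := orientation_const h_odd fr aw aw' ww.
  have ff : flip h (F sigma).1 w = flip h (F sigma).1 w'.
    apply/rowP => i; rewrite !mxE; case: ifP => // _.
    exact: sgr_eq_of_mul.
  have cid q : dom c q -> dom c' q -> Defs.coord c q = Defs.coord c' q.
    by move=> cq c'q; rewrite (monomial_chart_coord fanSigma mc cq)
      (monomial_chart_coord fanSigma mc' c'q) ff.
  exists id; last by move=> q _ _; rewrite jacobian_id det1.
  split; first exact: cid.
  apply: regular_smooth => [|j]; last by exists (fun y => y 0 j);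
    [exact: regular_coord|].
  have [_ _ _ _ co] := monomial_chart_in fanSigma mc (@subset_refl _ _).
  apply: co; last exact: subIsetl.
  by case: mc => _ _ oc1 _ _; case: mc' => _ _ oc2 _ _; exact: openI.
Qed.

End Sufficiency.

Lemma ray_generators {R : realType} {n : nat} (Sigma : set (set 'rV[R]_n)) (h :
  'cV['F_2]_n) :
  (forall b, (exists rho : set 'rV[R]_n,
     [/\ Sigma rho, is_ray rho, primitive b & rho (lattice_point b)]) ->
     modF2 b *m h = 1%:M) ->
  forall (sigma : Sigma) m b i, is_ray (val sigma) -> ray_basis (val sigma) m b i ->
     modF2 b *m h = 1%:M.
Proof.
move=> hb sigma m b i rs mbi; apply: hb; exists (val sigma); split=> //.
- exact: fan_mem.
- exact: ray_basis_primitive mbi.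
- have [_ _ ->] := mbi; exists 1; first exact: ler01.
  by rewrite scale1r.
Qed.

Theorem theorem2p2 (R : realType) (n : nat) (Sigma : set (set 'rV[R]_n))
  (fanSigma : rational_fan Sigma) :
  orientable (@toric_atlas R n Sigma) (@toric_open_part R n Sigma) <->
  exists (k : nat) (e : 'I_k -> 'rV[int]_n),
    sign_basis e /\
    forall (rho : set 'rV[R]_n) (b : 'rV[int]_n),
      Sigma rho -> is_ray rho -> primitive b -> rho (lattice_point b) ->
      exists J : {set 'I_k}, odd #|J| /\ sign_pow b = sign_prod e J.
Proof.
pose P := [set b : 'rV[int]_n | exists rho : set 'rV[R]_n,
  [/\ Sigma rho, is_ray rho, primitive b & rho (lattice_point b)]].
transitivity (exists h : 'cV['F_2]_n, forall b, P b -> modF2 b *m h = 1%:M); last first.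
  rewrite -(sign_basis_odd_functional P); split=> -[k [e [be Pe]]]; exists k, e;
    split=> //.
    by move=> rho b Srho rrho pb rb; apply: Pe; exists rho.
  by move=> b [rho [Srho rrho pb rb]]; exact: Pe Srho rrho pb rb.
split=> [orY|[h Ph] p _]; last first.
  exact: odd_functional_oriented (ray_generators Ph).
have [//|[s [sP os s0]]] := odd_functional_or_relation P; exfalso.
have Psigma b : P b -> exists (sigma : Sigma) m i, is_ray (val sigma) /\ ray_basis
  (val sigma) m b i.
  move=> [rho [Srho rrho pb rb]]; have [m [c [i mci]]] := ray_basis_exists rrho.
  exists (exist _ rho (mem_set Srho)), m, i; split=> //=.
  by rewrite (primitive_ray mci pb rb).
(* An odd relation is nonempty, so the fan contains a ray and therefore its vertex. *)
have S0 : Sigma [set 0].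
  case: s sP os {s0} => // b s sP _;
    have [sigma [m [i [rs _]]]] := Psigma b (sP _ (mem_head _ _)).
  by apply: (vertex_in_fan fanSigma (fan_mem sigma)); right.
pose p0 := affine_inclusion (torus_point S0 0).
have Mp0 : (@toric_open_part R n Sigma) p0.
  by apply: (range_open_part fanSigma (vertex_dim S0)); exists (torus_point S0 0).
have [B [BW Bc Bs Bo]] := orY _ Mp0.
apply: (no_odd_relation fanSigma BW Bc Bs Bo _ _ os s0).
  exact: connected_component_refl.
by move=> b /sP; exact: Psigma.
Qed.
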